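(* Consider the expectation problem (EX). Suppose Assumption A and Assumption V hold and $g_k$ is the sampled estimate with the sample-size rule (so Condition C holds in (EX)). Run the Algorithm with Option I with $\tilde\eta_k=\tilde\eta\in(0,1)$, $\tilde\iota_0\in\left[0,\sqrt{\frac{1-\tilde\eta}{2}}\right)$, $\tilde\delta_k=\frac{1}{(k+1)^{1+\nu}}$ for all $k\ge0$ with some $\nu>0$, and $\alpha_k=\alpha\le\frac{1-\tilde\eta}{2L}$. For $\epsilon>0$ let $K_\epsilon$ be the first iteration index $k$ at which $\min\{\mathbb E[\|R^{true}_{\alpha}(x_k)\|^2],\|R^{true}_{\alpha}(x_k)\|^2\}\le\epsilon$. Then the number of stochastic gradient evaluations $\sum_{k=0}^{K_\epsilon-1}|S_k|$ is $\mathcal O(\epsilon^{-(2+\nu)})$. If instead $\tilde\delta_k=0$ for all $k$, it is $\mathcal O(\epsilon^{-2})$.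
   Context: Problem: minimize $\phi(x)=f(x)+h(x)$ over $x\in\mathbb{R}^d$. Assumption A: $f:\mathbb{R}^d\to\mathbb{R}$ is continuously differentiable with $L$-Lipschitz continuous gradient ($L>0$), and $h:\mathbb{R}^d\to\mathbb{R}\cup\{+\infty\}$ is closed, convex and proper; $\phi^*=\inf\phi>-\infty$. Expectation problem (EX): $f(x)=\mathbb E_{\xi\sim\mathcal P}[F(x,\xi)]$. For $\alpha>0$, $\mathrm{prox}_{\alpha,h}(y)=\arg\min_{x\in\mathbb{R}^d}\{h(x)+\frac{1}{2\alpha}\|x-y\|^2\}$. Algorithm: given $x_0\in\mathbb{R}^d$, $y_0=x_0$, step sizes $\alpha_k>0$ and parameters $\beta_k$, for $k=0,1,2,\dots$: compute an estimate $g_k$ of $\nabla f(y_k)$; set $x_{k+1}=\mathrm{prox}_{\alpha_k,h}(y_k-\alpha_kg_k)$; under Option I set $y_{k+1}=x_{k+1}$, under Option II set $y_{k+1}=x_{k+1}+\beta_{k+1}(x_{k+1}-x_k)$. Define $R_{\alpha_k}(y_k)=\frac{1}{\alpha_k}(y_k-x_{k+1})$, $\hat x_{k+1}=\mathrm{prox}_{\alpha_k,h}(y_k-\alpha_k\nabla f(y_k))$ and $R^{true}_{\alpha_k}(y_k)=\frac{1}{\alpha_k}(y_k-\hat x_{k+1})$. Let $\mathcal G_k$ be the $\sigma$-algebra generated by $x_0,g_0,\dots,g_{k-1}$, $\mathbb E_k[\cdot]=\mathbb E[\cdot\mid\mathcal G_k]$, and $\mathbb E[\cdot]$ is total expectation.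 Condition C in (EX): for all $k\ge0$, $\mathbb E_k[\|g_k-\nabla f(y_k)\|^2]\le\frac{\tilde\eta_k^2}{4}\|\mathbb E_k[R_{\alpha_k}(y_k)]\|^2+\tilde\iota_0^2\tilde\delta_k^2$ with $\tilde\eta_k\in[0,1)$, $\tilde\iota_0\ge0$, $\tilde\delta_k\ge0$. Assumption V in (EX): there is $\sigma\ge0$ with $\mathbb E[\|\nabla F(y_k,\xi)-\nabla f(y_k)\|^2\mid\mathcal G_k]\le\sigma^2$ for all $k$, $\xi\sim\mathcal P$ independent of $\mathcal G_k$. Sampled estimate with sample-size rule: $g_k=\frac{1}{|S_k|}\sum_{\xi\in S_k}\nabla F(y_k,\xi)$, $S_k$ a set of i.i.d. samples from $\mathcal P$ independent of $\mathcal G_k$, with $|S_k|=\left\lceil\sigma^2/\left(\frac{\tilde\eta_k^2}{4}\|\mathbb E_k[R_{\alpha_k}(y_k)]\|^2+\tilde\iota_0^2\tilde\delta_k^2\right)\right\rceil$; each iteration costs $|S_k|$ stochastic gradient evaluations.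
   Formalization: The formal theorem also assumes that the stochastic gradient is unbiased, E[∇F(y,ξ)] = ∇f(y) for all y (the claim fails without it), that the denominator in the sample-size rule is always positive, and that at least one sample is drawn. *)

(* Defs.v *)
From HB Require Import structures.
From mathcomp Require Import all_boot all_order all_algebra.
From mathcomp Require Import all_classical all_reals all_analysis.
Import Order.TTheory GRing.Theory Num.Theory.
Import numFieldNormedType.Exports.

Set Implicit Arguments.
Unset Strict Implicit.
Unset Printing Implicit Defensive.

Local Open Scope classical_set_scope.
Local Open Scope ring_scope.

Definition dotv (R : realType) (d : nat) (u v : 'rV[R]_d) : R :=
  \sum_(i < d) u ord0 i * v ord0 i.

Definition nrm2 (R : realType) (d : nat) (u : 'rV[R]_d) : R := dotv u u.

Definition enorm (R : realType) (d : nat) (u : 'rV[R]_d) : R := Num.sqrt (nrm2 u).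

Definition has_gradient (R : realType) (d : nat)
  (f : 'rV[R]_d -> R) (gf : 'rV[R]_d -> 'rV[R]_d) : Prop :=
  forall x, differentiable f x /\ forall v, 'd f x v = dotv (gf x) v.

Definition smooth_L (R : realType) (d : nat) (L : R)
  (f : 'rV[R]_d -> R) (gf : 'rV[R]_d -> 'rV[R]_d) : Prop :=
  has_gradient f gf /\ continuous gf /\
  forall x y, enorm (gf x - gf y) <= L * enorm (x - y).

Definition proper_fun (R : realType) (d : nat) (h : 'rV[R]_d -> \bar R) : Prop :=
  (forall x, h x != -oo%E) /\ exists x, h x \is a fin_num.

Definition convex_fun (R : realType) (d : nat) (h : 'rV[R]_d -> \bar R) : Prop :=
  forall (x y : 'rV[R]_d) (t : R), 0 <= t <= 1 ->
    (h (t *: x + (1 - t) *: y)%R <= t%:E * h x + (1 - t)%:E * h y)%E.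

Definition closed_fun (R : realType) (d : nat) (h : 'rV[R]_d -> \bar R) : Prop :=
  closed [set p : 'rV[R]_d * R | (h p.1 <= p.2%:E)%E].

Definition is_prox (R : realType) (d : nat) (h : 'rV[R]_d -> \bar R) (a : R)
  (y x : 'rV[R]_d) : Prop :=
  forall z, (h x + (nrm2 (x - y) / (2 * a))%:E <= h z + (nrm2 (z - y) / (2 * a))%:E)%E.

Definition prox (R : realType) (d : nat) (h : 'rV[R]_d -> \bar R) (a : R)
  (y : 'rV[R]_d) : 'rV[R]_d :=
  xget 0 [set x | is_prox h a y x].

Definition Rtrue (R : realType) (d : nat) (gf : 'rV[R]_d -> 'rV[R]_d)
  (h : 'rV[R]_d -> \bar R) (a : R) (y : 'rV[R]_d) : 'rV[R]_d :=
  a^-1 *: (y - prox h a (y - a *: gf y)).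

(* G_k = sigma(g_0, ..., g_{k-1}) (x_0 is deterministic) *)
Definition sigma_gen (d0 : measure_display) (T : measurableType d0)
  (R : realType) (d : nat) (g : nat -> T -> 'rV[R]_d) (k : nat) : set (set T) :=
  <<s [set A | exists (i : nat) (j : 'I_d) (B : set R),
         (i < k)%N /\ measurable B /\ A = (fun w => g i w ord0 j) @^-1` B] >>.

Definition sigma_of (d0 d1 : measure_display) (T : measurableType d0)
  (X : measurableType d1) (z : T -> X) : set (set T) :=
  [set A | exists B : set X, measurable B /\ A = z @^-1` B].

Definition mut_indep (d0 : measure_display) (T : measurableType d0)
  (R : realType) (P : probability T R) (I : eqType) (F : I -> set (set T)) : Prop :=
  forall (s : seq I) (A : I -> set T), uniq s ->
    (forall i, i \in s -> F i (A i)) ->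
    fine (P (\bigcap_(i in [set i | i \in s]) A i)) = \prod_(i <- s) fine (P (A i)).

Definition has_law (d0 d1 : measure_display) (T : measurableType d0)
  (X : measurableType d1) (R : realType) (P : probability T R)
  (Q : probability X R) (z : T -> X) : Prop :=
  measurable_fun setT z /\ forall B, measurable B -> P (z @^-1` B) = Q B.

Definition G_measurable (d0 : measure_display) (T : measurableType d0)
  (R : realType) (G : set (set T)) (Y : T -> R) : Prop :=
  forall B : set R, measurable B -> G (Y @^-1` B).

Definition is_cond_exp (d0 : measure_display) (T : measurableType d0)
  (R : realType) (P : probability T R) (G : set (set T)) (X Y : T -> R) : Prop :=
  G_measurable G Y /\ P.-integrable setT (EFin \o Y) /\
  forall A, G A -> (\int[P]_(w in A) (Y w)%:E = \int[P]_(w in A) (X w)%:E)%E.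

Definition is_cond_expv (d0 : measure_display) (T : measurableType d0)
  (R : realType) (d : nat) (P : probability T R) (G : set (set T))
  (X Y : T -> 'rV[R]_d) : Prop :=
  forall j : 'I_d, is_cond_exp P G (fun w => X w ord0 j) (fun w => Y w ord0 j).

Definition stop_cond (d0 : measure_display) (T : measurableType d0)
  (R : realType) (d : nat) (P : probability T R)
  (gf : 'rV[R]_d -> 'rV[R]_d) (h : 'rV[R]_d -> \bar R) (a : R)
  (x : nat -> T -> 'rV[R]_d) (eps : R) (k : nat) (w : T) : Prop :=
  (Order.min (\int[P]_v (nrm2 (Rtrue gf h a (x k v)))%:E)
             (nrm2 (Rtrue gf h a (x k w)))%:E <= eps%:E)%E.

(* sum_{k < K_eps} |S_k| = O(eps^{-p}) as eps -> 0, where K_eps is the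
   first index at which the stopping criterion holds (almost surely). *)
Definition complexity_O (d0 : measure_display) (T : measurableType d0)
  (R : realType) (P : probability T R)
  (cond : R -> nat -> T -> Prop) (N : nat -> T -> nat) (p : R) : Prop :=
  exists C eps0 : R, 0 < eps0 /\
    forall eps : R, 0 < eps <= eps0 ->
      {ae P, forall w, exists K : nat,
         cond eps K w /\ (forall k, (k < K)%N -> ~ cond eps k w) /\
         \sum_(k < K) (N k w)%:R <= C * eps `^ (- p)}.

(* Main.v *)
(* Before the stopping time both E|R_true|^2 and |R_true|^2 exceed eps.  The
   expectation can do so only O(1/eps) times, because the descent inequality,
   summed along a path and then integrated, makes E|R_true(x_k)|^2 summable over
   k >= 1; k = 0 is excluded since h(x_0) may be +oo.  Conversely
   |E_k R - R_true|^2 <= E_k|g_k - grad f|^2 bounds |R_true|^2 almost surely by a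
   multiple of the denominator in the sample-size rule, so each of these
   iterations draws O(1/eps) samples.  The total is O(eps^-2) in both regimes,
   which for eps <= 1 is stronger than O(eps^-(2+nu)).

   Condition C is a variance computation: the noise terms are orthogonal in L^2
   given G_k by Fubini, which requires joint measurability of (y, s) |-> grad F;
   it holds because F is a Caratheodory function and grad F is a pointwise limit
   of its difference quotients. *)

Require Import Defs.
From HB Require Import structures.
From mathcomp Require Import all_boot all_order all_algebra.
From mathcomp Require Import all_classical all_reals all_analysis.
From mathcomp Require Import measurable_realfun ring lra.
Import Order.TTheory GRing.Theory Num.Theory.
Import numFieldNormedType.Exports.

Set Implicit Arguments.
Unset Strict Implicit.
Unset Printing Implicit Defensive.

Local Open Scope classical_set_scope.
Local Open Scope ring_scope.

(** * Euclidean space, smooth functions and proximal operators *)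

(** Conditional expectations occur only as versions characterised by their integrals over sets of
    [G_k]. Condition C and Jensen's inequality are therefore proved as inequalities between
    integrals over an arbitrary [A] in [G_k]; an almost sure bound is extracted afterwards by
    testing on the set where it would fail. These integrals must be finite before they can be
    subtracted, so square integrability of errors, residuals and iterates is propagated along the
    recursion from the deterministic [x0].

    The almost sure multiple is [2 * (1 + 4 / eta ^+ 2)], since the denominator dominates both
    [nrm2 (ER k w - rtrue k w)] and [eta ^+ 2 / 4 * nrm2 (ER k w)]. The sequence [delta] enters the
    summation only through a bound on the sum of [delta k.+1 ^+ 2], so one complexity lemma serves
    both regimes. *)

Lemma normr_lt_sqr (R : realDomainType) (x e : R) :
  0 < e -> x ^+ 2 < e ^+ 2 -> `|x| < e.
Proof. by move=> e0 xe; rewrite ltr_norml; apply/andP; split; nra. Qed.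

Section euclidean.
Context {R : realType} {d : nat}.
Implicit Types (u v w : 'rV[R]_d) (t : R).

Lemma dotvC u v : dotv u v = dotv v u.
Proof. by apply: eq_bigr => i _; rewrite mulrC. Qed.

Lemma dotvDl u v w : dotv (u + v) w = dotv u w + dotv v w.
Proof. by rewrite -big_split; apply: eq_bigr => i _; rewrite mxE mulrDl. Qed.

Lemma dotvDr u v w : dotv w (u + v) = dotv w u + dotv w v.
Proof. by rewrite dotvC dotvDl ![dotv w _]dotvC. Qed.

Lemma dotvZl t u v : dotv (t *: u) v = t * dotv u v.
Proof. by rewrite mulr_sumr; apply: eq_bigr => i _; rewrite mxE mulrA. Qed.

Lemma dotvZr t u v : dotv u (t *: v) = t * dotv u v.
Proof. by rewrite dotvC dotvZl dotvC. Qed.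

Lemma dotvNl u v : dotv (- u) v = - dotv u v.
Proof. by rewrite -scaleN1r dotvZl mulN1r. Qed.

Lemma dotvNr u v : dotv u (- v) = - dotv u v.
Proof. by rewrite dotvC dotvNl dotvC. Qed.

Definition dotvE := (dotvDl, dotvDr, dotvNl, dotvNr, dotvZl, dotvZr).

Lemma nrm2_ge0 u : 0 <= nrm2 u.
Proof. by apply: sumr_ge0 => i _; rewrite -expr2 sqr_ge0. Qed.

Lemma nrm2Z t u : nrm2 (t *: u) = t ^+ 2 * nrm2 u.
Proof. by rewrite /nrm2 dotvZl dotvZr mulrA expr2. Qed.

Lemma nrm2N u : nrm2 (- u) = nrm2 u.
Proof. by rewrite /nrm2 dotvNl dotvNr opprK. Qed.

Lemma nrm2BC u v : nrm2 (u - v) = nrm2 (v - u).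
Proof. by rewrite -nrm2N opprB. Qed.

Lemma nrm2D u v : nrm2 (u + v) = nrm2 u + 2 * dotv u v + nrm2 v.
Proof. by rewrite /nrm2 !dotvE [dotv v u]dotvC; lra. Qed.

Lemma nrm20 : nrm2 (0 : 'rV[R]_d) = 0.
Proof. by rewrite -(scale0r 0) nrm2Z expr0n mul0r. Qed.

(** Expand [0 <= nrm2 (u - t *: v)] and divide by [2 * t]. *)
Lemma dotv_young t u v : 0 < t ->
  dotv u v <= (t^-1 * nrm2 u + t * nrm2 v) / 2.
Proof.
move=> t0; have := nrm2_ge0 (u - t *: v).
rewrite nrm2D nrm2N nrm2Z dotvNr dotvZr => H.
have : 0 <= t^-1 * (nrm2 u + 2 * - (t * dotv u v) + t ^+ 2 * nrm2 v).
  by rewrite mulr_ge0// invr_ge0 ltW.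
have -> : t^-1 * (nrm2 u + 2 * - (t * dotv u v) + t ^+ 2 * nrm2 v) =
  t^-1 * nrm2 u - 2 * dotv u v + t * nrm2 v by field; rewrite gt_eqF.
lra.
Qed.

Lemma nrm2D_le u v : nrm2 (u + v) <= 2 * (nrm2 u + nrm2 v).
Proof. by have := dotv_young u v ltr01; rewrite nrm2D invr1; lra. Qed.

Lemma sqr_coord_le u j : u ord0 j ^+ 2 <= nrm2 u.
Proof.
rewrite /nrm2 /dotv (bigD1 j)//= -expr2 lerDl.
by apply: sumr_ge0 => i _; rewrite -expr2 sqr_ge0.
Qed.

Lemma cvg_coord (T : Type) (F : set_system T) (FF : Filter F)
    (u : T -> 'rV[R]_d) (l : 'rV[R]_d) :
  (forall j, u x ord0 j @[x --> F] --> l ord0 j) -> u @ F --> l.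
Proof.
move=> ul; apply/cvg_mx_entourageP => A.
rewrite -entourage_ballE => -[e /= e0 eA].
have : forall j, \forall x \near F, ball (l ord0 j) e (u x ord0 j).
  by move=> j; exact: (cvg_ball (ul j) e0).
move=> /filter_forall H; near=> x => i j.
rewrite inE (ord1 i); apply: eA => /=.
by move: j; near: x; exact: H.
Unshelve. all: by end_near. Qed.

Lemma nrm2_cvg (T : Type) (F : set_system T) (FF : Filter F)
    (u : T -> 'rV[R]_d) (l : 'rV[R]_d) :
  nrm2 (u x - l) @[x --> F] --> 0 -> u @ F --> l.
Proof.
move=> /cvgrPdist_lt ul; apply: cvg_coord => j; apply/cvgrPdist_lt => e e0.
have e20 : 0 < e ^+ 2 by rewrite exprn_gt0.
near=> x; apply: normr_lt_sqr => //.
have := sqr_coord_le (u x - l) j; rewrite !mxE -sqrrN opprB => /le_lt_trans; apply.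
have : `|0 - nrm2 (u x - l)| < e ^+ 2 by near: x; exact: ul.
by rewrite sub0r normrN ger0_norm ?nrm2_ge0.
Unshelve. all: by end_near. Qed.

Lemma nrm2_continuous : continuous (@nrm2 R d).
Proof.
move=> x; apply: (cvg_big add_continuous (nbhs_filter x)) => i _.
by apply: cvgM; exact: coord_continuous.
Qed.

Lemma lip_continuous (phi : 'rV[R]_d -> 'rV[R]_d) C :
  (forall x y, nrm2 (phi x - phi y) <= C * nrm2 (x - y)) -> continuous phi.
Proof.
move=> Hphi x.
suff : nrm2 (phi z - phi x) @[z --> x] --> 0 by move=> /nrm2_cvg; exact.
have : C * nrm2 (z - x) @[z --> x] --> C * nrm2 (x - x).
  apply: (@cvgM _ _ (nbhs x) _ (fun=> C)); first exact: cvg_cst.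
  apply: (@cvg_comp _ _ _ (fun z => z - x) (@nrm2 R d)).
    exact: (cvgB (@cvg_id _ (nbhs x)) (cvg_cst x)).
  exact: nrm2_continuous.
rewrite subrr nrm20 mulr0 => H; apply: squeeze_cvgr (cvg_cst 0) H.
by apply: nearW => z; rewrite nrm2_ge0 Hphi.
Qed.

End euclidean.

(** * Functions with Lipschitz gradient *)

Section smooth.
Context {R : realType} {d : nat}.
Variables (L : R) (f : 'rV[R]_d -> R) (gf : 'rV[R]_d -> 'rV[R]_d).
Hypotheses (L0 : 0 < L) (fL : smooth_L L f gf).

Lemma has_gradient_is_derive (F : 'rV[R]_d -> R) (GF : 'rV[R]_d -> 'rV[R]_d)
    x v (t : R) : has_gradient F GF ->
  is_derive t 1 (fun s : R => F (x + s *: v)) (dotv (GF (x + t *: v)) v).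
Proof.
move=> gF; have [dF eF] := gF (x + t *: v).
have dv : derivable F (x + t *: v) v by exact: diff_derivable.
have E : (fun s => s^-1 *: (((fun s0 : R => F (x + s0 *: v)) \o shift t) (s *: 1)
     - F (x + t *: v))) =
   (fun s => s^-1 *: ((F \o shift (x + t *: v)) (s *: v) - F (x + t *: v))).
  apply/funext => s /=; congr (_ *: (F _ - _)).
  by rewrite scalerDl addrCA [s *: 1]mulr1.
apply: DeriveDef.
  by rewrite /derivable E.
by rewrite /derive E -eF -deriveE.
Qed.

Lemma smooth_nrm2 x y : nrm2 (gf x - gf y) <= L ^+ 2 * nrm2 (x - y).
Proof.
have [_ [_ /(_ x y)]] := fL; rewrite /enorm => H.
have : Num.sqrt (nrm2 (gf x - gf y)) ^+ 2 <= (L * Num.sqrt (nrm2 (x - y))) ^+ 2.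
  rewrite ler_sqr ?nnegrE ?sqrtr_ge0//.
  by rewrite mulr_ge0 ?sqrtr_ge0// ltW.
by rewrite exprMn !sqr_sqrtr ?nrm2_ge0.
Qed.

(** The mean value theorem replaces the usual integral of the gradient along the segment. *)
Lemma descent x v : f (x + v) <= f x + dotv (gf x) v + L / 2 * nrm2 v.
Proof.
have [gf0 _] := fL.
(* With the linear and quadratic terms subtracted, the claim reads [psi 1 <= psi 0], so it is enough
   that [dpsi] is nonpositive at the mean value point. *)
pose psi (t : R) := f (x + t *: v) - t * dotv (gf x) v - t ^+ 2 * (L / 2 * nrm2 v).
pose dpsi (t : R) := dotv (gf (x + t *: v)) v - dotv (gf x) v - t * (L * nrm2 v).
have Dpsi (t : R) : is_derive t 1 psi (dpsi t).
  have D1 := @has_gradient_is_derive f gf x v t gf0.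
  rewrite /psi /dpsi; apply: is_derive_eq.
  by rewrite /= /GRing.scale /= !mulr0 ?add0r ?addr0 ?mulr1; field.
have cpsi : {within `[0, 1], continuous psi}.
  apply: derivable_within_continuous => s _.
  by have [] := Dpsi s.
have [c] := MVT_segment ler01 (fun s _ => Dpsi s) cpsi.
rewrite in_itv /= => /andP[c0 _]; rewrite /psi /dpsi !(scale0r, scale1r, addr0).
suff : dotv (gf (x + c *: v)) v - dotv (gf x) v <= c * (L * nrm2 v) by lra.
(* The Young weight [L * c] makes both halves equal to [L * c * nrm2 v]; it must be positive, so
   [c = 0] is treated apart. *)
move: c0; rewrite le_eqVlt => /predU1P[<-|c0].
  by rewrite scale0r addr0 subrr mul0r.
have Lc : 0 < L * c by rewrite mulr_gt0.
have := smooth_nrm2 (x + c *: v) x; rewrite [x + _ - x]addrAC subrr add0r nrm2Z => H.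
have := dotv_young (gf (x + c *: v) - gf x) v Lc; rewrite dotvDl dotvNl.
move=> /le_trans; apply.
have : (L * c)^-1 * nrm2 (gf (x + c *: v) - gf x) <=
       (L * c)^-1 * (L ^+ 2 * (c ^+ 2 * nrm2 v)).
  by rewrite ler_pM2l// invr_gt0.
have -> : (L * c)^-1 * (L ^+ 2 * (c ^+ 2 * nrm2 v)) = L * c * nrm2 v.
  by field; rewrite !gt_eqF.
lra.
Qed.

(** From [f + h >= m] and the quadratic upper bound on [f] around [y], [h] has a quadratic minorant
    of curvature [- L]. The prox term has curvature [a^-1 > L], and the surplus [t = a^-1 - L]
    absorbs the linear term by Young. This bounds the prox problem below without an affine minorant
    of [h]. *)
Lemma smooth_minorant (h : 'rV[R]_d -> \bar R) (a m : R) y :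
    0 < a -> a * L < 1 -> (forall z, (m%:E <= (f z)%:E + h z)%E) ->
  exists B : R, forall z, (B%:E <= h z + (nrm2 (z - y) / (2 * a))%:E)%E.
Proof.
move=> a0 aL1 hm; pose t := a^-1 - L.
have t0 : 0 < t by rewrite subr_gt0 -[_^-1]mul1r ltr_pdivlMr// mulrC.
exists (m - f y - t^-1 * nrm2 (gf y) / 2) => z.
have := hm z; case: (h z) => [r||]; rewrite ?addeNy ?addye// ?leey// -!EFinD !lee_fin.
have := descent y (z - y); rewrite addrC subrK.
have := dotv_young (gf y) (z - y) t0.
have -> : t * nrm2 (z - y) = 2 * (nrm2 (z - y) / (2 * a)) - L * nrm2 (z - y).
  by rewrite /t; field; rewrite gt_eqF.
lra.
Qed.

End smooth.

(** * Existence, optimality condition and nonexpansiveness of the proximal point *)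

Section prox.
Context {R : realType} {d : nat}.
Variables (h : 'rV[R]_d -> \bar R) (a : R).
Hypotheses (hp : proper_fun h) (hc : convex_fun h) (hcl : closed_fun h).
Hypothesis a0 : 0 < a.
Hypothesis hb : forall y, exists B : R,
  forall z, (B%:E <= h z + (nrm2 (z - y) / (2 * a))%:E)%E.

Lemma epi_convex x y (r s t : R) : 0 <= t <= 1 ->
  (h x <= r%:E)%E -> (h y <= s%:E)%E ->
  (h (t *: x + (1 - t) *: y)%R <= (t * r + (1 - t) * s)%:E)%E.
Proof.
move=> t01 hx hy; apply: (le_trans (hc x y t01)).
have /andP[t0 t1] := t01.
by rewrite [leRHS]EFinD !EFinM; apply: leeD; apply: lee_wpmul2l => //;
  rewrite lee_fin// subr_ge0.
Qed.

(** Parallelogram identity; its last term is the strong convexity that makes minimizing sequences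
    Cauchy. *)
Lemma nrm2_midpoint (u v y : 'rV[R]_d) :
  nrm2 (2^-1 *: u + (1 - 2^-1) *: v - y) =
  (nrm2 (u - y) + nrm2 (v - y)) / 2 - nrm2 (u - v) / 4.
Proof.
have -> : 2^-1 *: u + (1 - 2^-1) *: v - y = 2^-1 *: ((u - y) + (v - y)).
  by apply/matrixP => i j; rewrite !mxE; field.
have -> : nrm2 (u - v) = nrm2 ((u - y) - (v - y)).
  by rewrite opprB addrA subrK.
move: (u - y) (v - y) => {}u {}v; rewrite nrm2Z !nrm2D nrm2N dotvNr.
by field.
Qed.

Lemma prox_exists y : exists x, is_prox h a y x.
Proof.
have [hNy [z0 hz0]] := hp; have [B hB] := hb y.
pose q z := nrm2 (z - y) / (2 * a).
(* The infimum is taken over epigraph pairs [(z, r)], so that it is an infimum of real numbers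
   although [h] may be [+oo]. *)
pose S := [set s | exists z r, (h z <= r%:E)%E /\ s = r + q z].
have S0 : S !=set0.
  by exists (fine (h z0) + q z0), z0, (fine (h z0)); rewrite fineK.
have Slb : lbound S B.
  move=> _ [z [r [hr ->]]]; rewrite -lee_fin; apply: (le_trans (hB z)).
  by rewrite EFinD leeD2r.
have hinf : has_inf S by split => //; exists B.
pose mu := inf S.
have muS z r : (h z <= r%:E)%E -> mu <= r + q z.
  by move=> hr; apply: ge_inf; [exists B|exists z, r].
have Hn n : exists zr : 'rV[R]_d * R,
    (h zr.1 <= zr.2%:E)%E /\ zr.2 + q zr.1 < mu + n.+1%:R^-1.
  have n0 : 0 < n.+1%:R^-1 :> R by rewrite invr_gt0.
  have [_ [z [r [hr ->]]] lt] := inf_adherent n0 hinf.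
  by exists (z, r).
have {Hn}[zr Hzr] := choice Hn.
pose z n := (zr n).1; pose r n := (zr n).2.
have hzr n : (h (z n) <= (r n)%:E)%E by have [] := Hzr n.
have lzr n : r n + q (z n) < mu + n.+1%:R^-1 by have [] := Hzr n.
have half01 : 0 <= (2^-1 : R) <= 1 by lra.
(* The midpoint of two near-minimizers still has value at least [mu], while its prox term is smaller
   than the average by [nrm2 (z n - z m) / (8 * a)]; this gain is at most the larger defect
   [n.+1%:R^-1]. *)
have zC n m : (n <= m)%N -> nrm2 (z n - z m) <= 8 * a * n.+1%:R^-1.
  move=> nm; have := muS _ _ (epi_convex half01 (hzr n) (hzr m)).
  rewrite /q nrm2_midpoint.
  have := lzr n; have := lzr m; rewrite /q.
  have : m.+1%:R^-1 <= n.+1%:R^-1 :> R by rewrite lef_pV2 ?posrE// ler_nat.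
  move=> h1 h2 h3 h4.
  have : nrm2 (z n - z m) / (8 * a) <= n.+1%:R^-1.
    have E : ((nrm2 (z n - y) + nrm2 (z m - y)) / 2 - nrm2 (z n - z m) / 4) / (2 * a)
      = (nrm2 (z n - y) / (2 * a) + nrm2 (z m - y) / (2 * a)) / 2 -
        nrm2 (z n - z m) / (8 * a) by field; rewrite gt_eqF.
    move: h1 h2 h3 h4; rewrite E.
    move: (m.+1%:R^-1) (n.+1%:R^-1) (nrm2 (z n - y) / _) (nrm2 (z m - y) / _).
    by move: (nrm2 _ / (8 * a)) => q1 e1 e2 q2 q3; lra.
  by rewrite ler_pdivrMr ?mulr_gt0// mulrC.
have : cauchy (z @ \oo).
  apply: cauchy_exP => e e0.
  have [n ne] : exists n : nat, 8 * a * n.+1%:R^-1 < e ^+ 2.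
    have := @near_infty_natSinv_lt R (PosNum (divr_gt0 (exprn_gt0 2 e0) (mulr_gt0 (ltr0n R 8) a0))).
    move=> [n _ /(_ n (leqnn n))] /=; rewrite ltr_pdivlMr ?mulr_gt0// mulrC => ?.
    by exists n.
  exists (z n); exists n => // m /= nm; split => // i j; rewrite (ord1 i).
  apply: normr_lt_sqr => //.
  apply: le_lt_trans (le_lt_trans (zC _ _ nm) ne).
  by have := sqr_coord_le (z n - z m) j; rewrite !mxE.
move=> /cauchy_cvg /cvg_ex[x zx].
have qx : q (z n) @[n --> \oo] --> q x.
  rewrite /q; apply: cvgM; last exact: cvg_cst.
  apply: (@cvg_comp _ _ _ (fun n => z n - y) (@nrm2 R d)).
    by apply: cvgB; [exact: zx|exact: cvg_cst].
  exact: nrm2_continuous.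
(* Since [r n + q (z n)] tends to [mu], the heights [r n] converge too, and closedness of the
   epigraph applies to the limit pair. *)
have rx : r n @[n --> \oo] --> mu - q x.
  have s1 : r n + q (z n) @[n --> \oo] --> mu.
    apply: (@squeeze_cvgr _ _ _ _ (fun=> mu) (fun n => mu + n.+1%:R^-1)).
    - by apply: nearW => n; rewrite muS//= ltW.
    - exact: cvg_cst.
    - rewrite -[X in _ --> X]addr0; apply: cvgD; first exact: cvg_cst.
      exact: cvg_harmonic.
  have : (r n + q (z n)) - q (z n) @[n --> \oo] --> mu - q x by exact: cvgB.
  by under eq_fun do rewrite addrK.
have hx : (h x <= (mu - q x)%:E)%E.
  apply: (@closed_cvg _ _ \oo _ (fun n => (z n, r n)) _ hcl _ (x, mu - q x)).
    exact: nearW.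
  exact: (cvg_pair zx rx).
exists x => z'.
have hz'Ny := hNy z'.
case E : (h z') hz'Ny => [s||]// _; last by rewrite addye// leey.
apply: (@le_trans _ _ mu%:E).
  by rewrite -[mu](subrK (q x)) EFinD leeD2r.
by rewrite -EFinD lee_fin; apply: muS; rewrite E.
Qed.

Lemma proxP y : is_prox h a y (prox h a y).
Proof. exact: (xgetPex 0 (prox_exists y)). Qed.

Lemma prox_fin_num y : h (prox h a y) \is a fin_num.
Proof.
have [hNy [z hz]] := hp; have := proxP y z; rewrite fin_numE hNy /=.
case: (h (prox h a y)) (hNy (prox h a y)) => [s||]//= _.
by rewrite addye// -(fineK hz).
Qed.

(** The subgradient inequality for [a^-1 *: (y - p)] at [p = prox h a y], derived from minimality
    along the segment from [p] to [z]. *)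
Lemma prox_variational y z :
  ((fine (h (prox h a y)) + a^-1 * dotv (y - prox h a y) (z - prox h a y))%:E
   <= h z)%E.
Proof.
set p := prox h a y; have [hNy _] := hp.
have hpf : (h p <= (fine (h p))%:E)%E by rewrite fineK// prox_fin_num.
case E : (h z) (hNy z) => [s||]// _; last by rewrite leey.
rewrite lee_fin; apply/ler_addgt0Pr => e e0.
have hz : (h z <= s%:E)%E by rewrite E.
(* Comparing [p] with [p + t *: (z - p)] and dividing by [t] leaves an error linear in [t]. *)
have key t : 0 < t <= 1 ->
  fine (h p) + a^-1 * dotv (y - p) (z - p) <= s + t * (nrm2 (z - p) / (2 * a)).
  move=> /andP[t0 t1].
  have t01 : 0 <= t <= 1 by rewrite ltW.
  have := le_trans (proxP y _) (leeD2r _ (epi_convex t01 hz hpf)).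
  rewrite -/p -[h p]fineK ?prox_fin_num// -!EFinD lee_fin.
  have -> : t *: z + (1 - t) *: p - y = (p - y) + t *: (z - p).
    by apply/matrixP => i j; rewrite !mxE; ring.
  rewrite [nrm2 (p - y + _)]nrm2D dotvZr nrm2Z -(opprB y p) nrm2N dotvNl => H.
  have : t * (fine (h p) + a^-1 * dotv (y - p) (z - p)) <=
         t * (s + t * (nrm2 (z - p) / (2 * a))).
    rewrite -subr_ge0; move: H; rewrite -subr_ge0 => /le_trans; apply.
    rewrite le_eqVlt; apply/orP; left; apply/eqP.
    by field; rewrite gt_eqF.
  by rewrite ler_pM2l.
pose c := nrm2 (z - p) / (2 * a).
have c0 : 0 <= c by rewrite divr_ge0 ?nrm2_ge0// mulr_ge0// ltW.
(* This gives [t * c <= e]; dividing by [c + 1] covers [c = 0]. *)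
pose t := Num.min 1 (e / (c + 1)).
have t0 : 0 < t by rewrite lt_min ltr01 divr_gt0// ltr_wpDl.
apply: (le_trans (key t _)); first by rewrite t0 /= ge_min lexx.
rewrite lerD2l -/c; apply: (@le_trans _ _ (e / (c + 1) * c)).
  by rewrite ler_wpM2r// ge_min lexx orbT.
rewrite mulrAC ler_pdivrMr ?ltr_wpDl//.
by rewrite ler_pM2l// lerDl.
Qed.

(** Adding the two variational inequalities gives firm nonexpansiveness,
    [nrm2 (x - y) <= dotv (u - v) (x - y)]; Young with weight 1 concludes. *)
Lemma prox_nonexpansive u v :
  nrm2 (prox h a u - prox h a v) <= nrm2 (u - v).
Proof.
have := prox_variational v (prox h a u); have := prox_variational u (prox h a v).
move: (prox h a u) (prox h a v) (prox_fin_num u) (prox_fin_num v) => x y hx hy.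
rewrite -(fineK hx) -(fineK hy) !lee_fin /= => H1 H2.
have H : a^-1 * (dotv (u - x) (y - x) + dotv (v - y) (x - y)) <= 0.
  by rewrite mulrDr; lra.
have {}H : dotv (u - x) (y - x) + dotv (v - y) (x - y) <= 0.
  by move: H; rewrite pmulr_rle0// invr_gt0.
have E : dotv (u - x) (y - x) + dotv (v - y) (x - y) =
  nrm2 (x - y) - dotv (u - v) (x - y).
  by rewrite /nrm2 !dotvE; ring.
have := dotv_young (u - v) (x - y) ltr01; rewrite invr1.
by move: H; rewrite E; lra.
Qed.

End prox.

(** * The proximal gradient step *)

Section prox_gradient.
Context {R : realType} {d : nat}.
Variables (L a m : R) (f : 'rV[R]_d -> R) (gf : 'rV[R]_d -> 'rV[R]_d).
Variable h : 'rV[R]_d -> \bar R.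
Hypotheses (L0 : 0 < L) (fL : smooth_L L f gf) (a0 : 0 < a) (aL1 : a * L < 1).
Hypotheses (hp : proper_fun h) (hc : convex_fun h) (hcl : closed_fun h).
Hypothesis hm : forall y, (m%:E <= (f y)%:E + h y)%E.

Let hb y := smooth_minorant L0 fL y a0 aL1 hm.

Definition proxgrad_step x g := prox h a (x - a *: g).

Definition residual x g := a^-1 *: (x - proxgrad_step x g).

Lemma Rtrue_residual x : Rtrue gf h a x = residual x (gf x).
Proof. by []. Qed.

Lemma proxgrad_step_fin_num x g : h (proxgrad_step x g) \is a fin_num.
Proof. exact: (prox_fin_num hp hc hcl a0 hb). Qed.

Lemma prox_continuous : continuous (prox h a).
Proof.
apply: (@lip_continuous _ _ _ 1) => u v; rewrite mul1r.
exact: (prox_nonexpansive hp hc hcl a0 hb).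
Qed.

Lemma residual_error x g : nrm2 (residual x g - Rtrue gf h a x) <= nrm2 (g - gf x).
Proof.
rewrite Rtrue_residual /residual -scalerBr nrm2Z.
have -> : x - proxgrad_step x g - (x - proxgrad_step x (gf x)) =
  proxgrad_step x (gf x) - proxgrad_step x g.
  by rewrite opprB addrC addrA subrK.
have := prox_nonexpansive hp hc hcl a0 hb (x - a *: gf x) (x - a *: g).
have -> : x - a *: gf x - (x - a *: g) = a *: (g - gf x).
  by rewrite opprB addrC addrA subrK scalerBr.
rewrite nrm2Z => H; rewrite exprVn mulrC ler_pdivrMr ?exprn_gt0// mulrC.
exact: H.
Qed.

(** A crude constant suffices: it serves only for continuity and square integrability. The factor
    [6 + 4 * a ^+ 2 * L ^+ 2] is [2 * (1 + 2 * (1 + a ^+ 2 * L ^+ 2))], from two uses of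
    [nrm2D_le]. *)
Lemma Rtrue_lip : exists C, 0 <= C /\
  forall x y, nrm2 (Rtrue gf h a x - Rtrue gf h a y) <= C * nrm2 (x - y).
Proof.
exists (a^-1 ^+ 2 * (6 + 4 * a ^+ 2 * L ^+ 2)); split.
  have := sqr_ge0 (a * L); rewrite exprMn => ?.
  by rewrite mulr_ge0 ?sqr_ge0// -mulrA addr_ge0// mulr_ge0.
move=> x y; rewrite /Rtrue -scalerBr nrm2Z -[leRHS]mulrA ler_pM2l ?exprn_gt0 ?invr_gt0//.
have := prox_nonexpansive hp hc hcl a0 hb (x - a *: gf x) (y - a *: gf y).
set p := prox _ _ _; set q := prox _ _ _; move: p q => p q.
have -> : x - a *: gf x - (y - a *: gf y) = (x - y) - a *: (gf x - gf y).
  by apply/matrixP => i j; rewrite !mxE; ring.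
have -> : x - p - (y - q) = (x - y) - (p - q).
  by apply/matrixP => i j; rewrite !mxE; ring.
have := nrm2D_le (x - y) (- (a *: (gf x - gf y))).
have := nrm2D_le (x - y) (- (p - q)).
rewrite !nrm2N nrm2Z.
have := ler_wpM2l (sqr_ge0 a) (smooth_nrm2 L0 fL x y).
rewrite mulrA; move: (nrm2 (x - y - _)) (nrm2 (x - y - _)).
move: (nrm2 (x - y)) (nrm2 (p - q)) (nrm2 (gf x - gf y)) => n1 n2 n3 n4 n5.
have -> : (6 + 4 * a ^+ 2 * L ^+ 2) * n1 = 6 * n1 + 4 * (a ^+ 2 * L ^+ 2 * n1).
  by ring.
by move: (a ^+ 2 * L ^+ 2 * n1) (a ^+ 2 * n3) => b c; lra.
Qed.

(** [fine] sends [+oo] to 0, so this is the true objective only where [h] is finite; every prox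
    output is such a point. *)
Definition objective x := f x + fine (h x).

Lemma objective_ge x : h x \is a fin_num -> m <= objective x.
Proof. by move=> hx; rewrite -lee_fin EFinD fineK. Qed.

(* Young's inequality with weight eta/2 splits the error term so that both
   halves stay below the descent a |residual|^2 once a L <= (1 - eta)/2. *)
Lemma proxgrad_descent (eta : R) x g : 0 < eta -> a <= (1 - eta) / (2 * L) ->
    h x \is a fin_num ->
  objective (proxgrad_step x g) + a * (3 / 4) * nrm2 (residual x g)
  <= objective x + a / eta * nrm2 (g - gf x).
Proof.
move=> eta0 aL hx.
have := prox_variational hp hc hcl a0 hb (x - a *: g) x.
rewrite -/(proxgrad_step x g) -[h x]fineK// lee_fin.
have xpE : proxgrad_step x g = x - a *: residual x g.
  by rewrite /residual scalerA divff ?gt_eqF// scale1r opprB addrC subrK.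
move: (residual x g) xpE => r xpE.
have := descent L0 fL x (- (a *: r)); rewrite -xpE.
rewrite nrm2N nrm2Z dotvNr dotvZr /objective.
have -> : x - a *: g - proxgrad_step x g = a *: (r - g).
  by rewrite xpE opprB addrC addrA subrK scalerBr.
have -> : x - proxgrad_step x g = a *: r by rewrite xpE opprB addrC subrK.
rewrite dotvZl dotvZr mulKf ?gt_eqF// dotvDl dotvNl -/(nrm2 _).
have eta20 : 0 < eta / 2 by lra.
have := dotv_young (g - gf x) r eta20; rewrite dotvDl dotvNl.
have aL2 : L * a <= (1 - eta) / 2.
  move: aL; rewrite ler_pdivlMr ?mulr_gt0// => ?; lra.
have [N0 a0'] := (nrm2_ge0 r, ltW a0).
move: (fine (h x)) (fine (h _)) (f _) (f _) N0 => hx' hy fy fx.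
move: (nrm2 r) (dotv g _) (dotv (gf x) _) (nrm2 (g - gf x)).
move=> N p q E N0 Y D V.
have aN : 0 <= a * N by rewrite mulr_ge0.
have := ler_wpM2r aN aL2 => LaN.
have := ler_wpM2l a0' Y.
have -> : a * (((eta / 2)^-1 * E + eta / 2 * N) / 2) = a / eta * E + eta / 4 * (a * N).
  by field; rewrite gt_eqF.
(* All nonlinear terms are expressed through common products, which become variables of a linear
   problem. *)
have E1 : L / 2 * (a ^+ 2 * N) = L * a * (a * N) / 2 by field.
have E2 : a * (3 / 4) * N = 3 / 4 * (a * N) by ring.
have E3 : (1 - eta) / 2 * (a * N) = a * N / 2 - eta * (a * N) / 2 by field.
have E4 : eta / 4 * (a * N) = eta * (a * N) / 4 by field.
move: D V LaN; rewrite E1 E2 E3 E4 !mulrBr.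
move: (a * p) (a * q) (a * N) (L * a * (a * N)) (eta * (a * N)) (a / eta * E).
by move=> *; lra.
Qed.

(** Replaces [proxgrad_descent] at a start where [h] may be [+oo]: the prox problem is compared with
    a fixed [z] in the domain of [h]. An affine bound in the squared error is enough for a finite
    expectation after one step. *)
Lemma proxgrad_first_step x : exists A B, 0 <= B /\
  forall g, objective (proxgrad_step x g) <= A + B * nrm2 (g - gf x).
Proof.
have [hNy [z hz]] := hp.
(* The terms with [z] come from the comparison point, [nrm2 (gf x) / 2] from Young, and
   [(1 + L) * a ^+ 2] from the squared step length, with the residual bounded by twice the error
   plus twice [Rtrue]. *)
exists (fine (h z) + nrm2 (z - x + a *: gf x) / a + f x + nrm2 (gf x) / 2
  + (1 + L) * a ^+ 2 * nrm2 (Rtrue gf h a x)), (a + (1 + L) * a ^+ 2).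
split; first by rewrite addr_ge0 ?mulr_ge0 ?sqr_ge0 ?addr_ge0 ?ltW.
move=> g.
have := proxP hp hc hcl a0 hb (x - a *: g) z.
rewrite -/(proxgrad_step x g) -[h z]fineK// -[h (proxgrad_step x g)]fineK ?proxgrad_step_fin_num//.
rewrite -!EFinD lee_fin.
have xpE : proxgrad_step x g = x + (- a) *: residual x g.
  by rewrite /residual scalerA mulNr divff ?gt_eqF// scaleN1r opprB addrC subrK.
have := descent L0 fL x ((- a) *: residual x g); rewrite -xpE => D.
have := dotv_young (gf x) ((- a) *: residual x g) ltr01 => Y.
have Q0 : 0 <= nrm2 (proxgrad_step x g - (x - a *: g)) / (2 * a).
  by rewrite divr_ge0 ?nrm2_ge0// mulr_ge0 ?ltW.
have -> : z - (x - a *: g) = (z - x + a *: gf x) + a *: (g - gf x).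
  by apply/matrixP => i j; rewrite !mxE; ring.
have Q1 : nrm2 ((z - x + a *: gf x) + a *: (g - gf x)) / (2 * a) <=
  nrm2 (z - x + a *: gf x) / a + a * nrm2 (g - gf x).
  rewrite ler_pdivrMr ?mulr_gt0//; apply: (le_trans (nrm2D_le _ _)).
  rewrite nrm2Z le_eqVlt; apply/orP; left; apply/eqP; field.
  by rewrite gt_eqF.
have RR := nrm2D_le (residual x g - Rtrue gf h a x) (Rtrue gf h a x).
rewrite subrK in RR.
have EE := residual_error x g.
move: D Y; rewrite invr1 mul1r mul1r nrm2Z sqrrN /objective => D Y H.
have P0 : 0 <= (1 + L) * a ^+ 2 by rewrite mulr_ge0 ?sqr_ge0 ?addr_ge0 ?ltW.
have RE : nrm2 (residual x g) <= 2 * (nrm2 (g - gf x) + nrm2 (Rtrue gf h a x)).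
  by apply: (le_trans RR); rewrite ler_pM2l// lerD2r.
have alg (fp fx hq hw c n r e rt q0 q1 q2 : R) :
    r <= 2 * (e + rt) -> fp <= fx + c + L / 2 * (a ^+ 2 * r) ->
    c <= (n + a ^+ 2 * r) / 2 -> hq + q0 <= hw + q2 -> 0 <= q0 ->
    q2 <= q1 + a * e ->
  fp + hq <= hw + q1 + fx + n / 2 + (1 + L) * a ^+ 2 * rt +
             (a + (1 + L) * a ^+ 2) * e.
  move=> /(ler_wpM2l P0).
  have -> : (1 + L) * a ^+ 2 * (2 * (e + rt)) =
    2 * ((1 + L) * a ^+ 2 * e + (1 + L) * a ^+ 2 * rt) by ring.
  have -> : (1 + L) * a ^+ 2 * r = a ^+ 2 * r + L * (a ^+ 2 * r) by ring.
  have -> : L / 2 * (a ^+ 2 * r) = (L * (a ^+ 2 * r)) / 2 by ring.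
  rewrite [(a + _) * e]mulrDl.
  move: (a * e) (a ^+ 2 * r) (L * (a ^+ 2 * r)) ((1 + L) * a ^+ 2 * e)
    ((1 + L) * a ^+ 2 * rt).
  by clear; move=> *; lra.
exact: (alg _ _ _ _ _ _ _ _ _ _ _ _ RE D Y H Q0 Q1).
Qed.

End prox_gradient.

(** * Measurability of vector-valued maps *)

Section vector_measurability.
Context {R : realType} {d : nat} {d0 : measure_display} {T : measurableType d0}.

(** Stated by coordinates and for any [T], so that the same lemmas apply to the sample space with
    its full sigma-algebra and with that of the history. *)
Definition mfunv (Y : T -> 'rV[R]_d) :=
  forall j, measurable_fun setT (fun w => Y w ord0 j).

Lemma measurable_floor_eq (u : T -> R) (m : int) :
  measurable_fun setT u -> measurable [set w | Num.floor (u w) = m].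
Proof.
move=> mu.
have -> : [set w | Num.floor (u w) = m] =
    setT `&` u @^-1` [set` `[m%:~R, (m + 1)%:~R[].
  rewrite setTI; apply/seteqP; split => w /=; rewrite in_itv /=.
    by move=> <-; exact: floor_itv.
  exact: floor_def.
exact: mu.
Qed.

Lemma caratheodory_measurable (d1 : measure_display) (S : measurableType d1)
    (F : 'rV[R]_d -> S -> R) (Y : T -> 'rV[R]_d) (z : T -> S) :
  (forall s, continuous (F^~ s)) -> (forall y, measurable_fun setT (F y)) ->
  mfunv Y -> measurable_fun setT z ->
  measurable_fun setT (fun w => F (Y w) (z w)).
Proof.
move=> cF mF mY mz.
(* Round Y to the grid of step 1/(n+1): the rounded map is countably valued. *)
pose q n (v : 'rV[int]_d) : 'rV[R]_d := \row_j ((v ord0 j)%:~R / n.+1%:R).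
pose r n w : 'rV[int]_d := \row_j Num.floor (n.+1%:R * Y w ord0 j).
apply: (@measurable_fun_cvg _ _ _ _ (fun n w => F (q n (r n w)) (z w))).
  move=> n _ B mB; rewrite setTI.
  (* On the set where the rounded vector equals [v], the map is [F (q n v) \o z], measurable by
     hypothesis; there are countably many [v]. *)
  have -> : (fun w => F (q n (r n w)) (z w)) @^-1` B =
    \bigcup_(v in [set: 'rV[int]_d])
      ((\bigcap_(j in [set: 'I_d])
         [set w | Num.floor (n.+1%:R * Y w ord0 j) = v ord0 j])
       `&` (F (q n v) \o z) @^-1` B).
    apply/seteqP; split => w /=.
      by move=> Bw; exists (r n w) => //; split => // j _ /=; rewrite mxE.
    move=> [v _ [vE]] /=; suff -> : r n w = v by [].
    by apply/rowP => j; rewrite mxE; exact: vE.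
  apply: countable_bigcupT_measurable => [|v]; first exact: countableP.
  apply: measurableI.
    apply: fin_bigcap_measurable => [|j _]; first exact: finite_finset.
    apply: measurable_floor_eq; apply: measurable_funM => //; exact: mY.
  by rewrite -[X in measurable X]setTI; apply: measurableT_comp.
move=> w _; apply: (@cvg_comp _ _ _ (fun n => q n (r n w)) (F^~ (z w)) _ (nbhs (Y w))).
  apply: cvg_coord => j.
  have H n : Y w ord0 j - n.+1%:R^-1 <= q n (r n w) ord0 j <= Y w ord0 j.
    rewrite !mxE; have /andP[] := floor_itv (n.+1%:R * Y w ord0 j).
    rewrite intrD => h1 h2; apply/andP; split; last by rewrite ler_pdivrMr// [leRHS]mulrC.
    by rewrite ler_pdivlMr// mulrBl mulVf// lerBlDr ltW// [ltLHS]mulrC.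
  apply: (@squeeze_cvgr _ _ _ _ (fun n => Y w ord0 j - n.+1%:R^-1) (fun=> Y w ord0 j)).
  - exact: nearW.
  - rewrite -[X in _ --> X]subr0; apply: cvgB; first exact: cvg_cst.
    exact: cvg_harmonic.
  - exact: cvg_cst.
exact: cF.
Qed.

Lemma continuous_mfunv (phi : 'rV[R]_d -> R) (Y : T -> 'rV[R]_d) :
  continuous phi -> mfunv Y -> measurable_fun setT (phi \o Y).
Proof.
move=> cphi mY.
exact: (@caratheodory_measurable _ T (fun y _ => phi y) Y id).
Qed.

Lemma continuous_comp_mfunv (phi : 'rV[R]_d -> 'rV[R]_d) (Y : T -> 'rV[R]_d) :
  continuous phi -> mfunv Y -> mfunv (phi \o Y).
Proof.
move=> cphi mY j; apply: (continuous_mfunv (phi := fun y => phi y ord0 j)) => //.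
move=> y; apply: (@cvg_comp _ _ _ phi (fun u => u ord0 j) _ (nbhs (phi y))).
  exact: cphi.
exact: coord_continuous.
Qed.

Lemma mfunvD Y Z : mfunv Y -> mfunv Z -> mfunv (fun w => Y w + Z w).
Proof.
move=> mY mZ j; rewrite [X in measurable_fun _ X](_ : _ =
  (fun w => Y w ord0 j + Z w ord0 j)); last by apply/funext => w; rewrite mxE.
exact: measurable_funD.
Qed.

Lemma mfunvZ c Y : mfunv Y -> mfunv (fun w => c *: Y w).
Proof.
move=> mY j; rewrite [X in measurable_fun _ X](_ : _ =
  (fun w => c * Y w ord0 j)); last by apply/funext => w; rewrite mxE.
by apply: measurable_funM.
Qed.

Lemma mfunvB Y Z : mfunv Y -> mfunv Z -> mfunv (fun w => Y w - Z w).
Proof.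
move=> mY mZ; have -> : (fun w => Y w - Z w) = (fun w => Y w + (-1) *: Z w).
  by apply/funext => w; rewrite scaleN1r.
by apply: mfunvD => //; exact: mfunvZ.
Qed.

Lemma measurable_dotv Y Z : mfunv Y -> mfunv Z ->
  measurable_fun setT (fun w => dotv (Y w) (Z w)).
Proof.
by move=> mY mZ; apply: measurable_sum => j; exact: measurable_funM.
Qed.

Lemma measurable_nrm2 Y : mfunv Y -> measurable_fun setT (fun w => nrm2 (Y w)).
Proof. by move=> mY; exact: measurable_dotv. Qed.

Lemma gradient_measurable (d1 : measure_display) (S : measurableType d1)
    (F : 'rV[R]_d -> S -> R) (GF : 'rV[R]_d -> S -> 'rV[R]_d)
    (Y : T -> 'rV[R]_d) (z : T -> S) :
  (forall s, has_gradient (F^~ s) (GF^~ s)) ->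
  (forall y, measurable_fun setT (F y)) ->
  mfunv Y -> measurable_fun setT z -> mfunv (fun w => GF (Y w) (z w)).
Proof.
move=> gF mF mY mz j.
have cF s : continuous (F^~ s).
  by move=> y; apply: differentiable_continuous; have [] := gF s y.
pose e : 'rV[R]_d := delta_mx ord0 j.
pose D n w := n.+1%:R * (F (Y w + n.+1%:R^-1 *: e) (z w) - F (Y w) (z w)).
apply: (@measurable_fun_cvg _ _ _ _ D).
  move=> n; apply: measurable_funM => //; apply: measurable_funB.
    by apply: caratheodory_measurable => //; apply: mfunvD => // i.
  exact: caratheodory_measurable.
move=> w _; have [dF eF] := has_gradient_is_derive (Y w) e 0 (gF (z w)).
(* The derivative is a limit over punctured neighbourhoods of 0, and these steps are nonzero. *)
have h0 : n.+1%:R^-1 @[n --> \oo] --> (0 : R)^'.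
  move=> A hA; have [N _ HN] := @cvg_harmonic R _ hA; exists N => // n /HN /=.
  by apply; rewrite gt_eqF// invr_gt0.
have {}dF := cvg_comp _ _ h0 dF.
rewrite -/(derive _ _ _) eF in dF.
have -> : GF (Y w) (z w) ord0 j = dotv (GF (Y w + 0 *: e) (z w)) e.
  rewrite scale0r addr0 /dotv (bigD1 j)//= big1 => [|i ij].
    by rewrite mxE !eqxx mulr1 addr0.
  by rewrite mxE eqxx (negbTE ij) mulr0.
apply: cvg_trans dF; apply: near_eq_cvg; apply: nearW => n /=.
rewrite /D !scale0r !addr0 /shift /= invrK.
by rewrite [_ *: (1 : R)]mulr1 [_ *: (_ - _)]/GRing.scale.
Qed.

End vector_measurability.

(** * Independence, integrals and conditional expectation *)

Section independence.
Context {R : realType} {d0 : measure_display} {T : measurableType d0}.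
Variable P : probability T R.

(** Independence makes the law of [(u, z)] the product of the law of [u] and [Q]; Fubini then
    integrates over [s] first, where the integral vanishes. *)
Lemma indep_integral_eq0 (d1 d2 : measure_display) (U : measurableType d1)
    (S : measurableType d2) (Q : probability S R) (u : T -> U) (z : T -> S)
    (psi : U * S -> R) :
  measurable_fun setT u -> measurable_fun setT z ->
  (forall A B, measurable A -> measurable B ->
     P (u @^-1` A `&` z @^-1` B) = (P (u @^-1` A) * Q B)%E) ->
  measurable_fun setT psi ->
  P.-integrable setT (fun w => (psi (u w, z w))%:E) ->
  (forall a, (\int[Q]_s (psi (a, s))%:E = 0)%E) ->
  (\int[P]_w (psi (u w, z w))%:E = 0)%E.
Proof.
move=> mu mz uz mpsi ipsi psi0.
have muz : measurable_fun setT (fun w => (u w, z w)) by exact: measurable_fun_pair.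
pose X : {mfun T >-> U} := HB.pack u (isMeasurableFun.Build _ _ _ _ u mu).
pose XZ : {mfun T >-> (U * S)%type} :=
  HB.pack (fun w => (u w, z w)) (isMeasurableFun.Build _ _ _ _ _ muz).
have mE : measurable_fun setT (EFin \o psi) by exact/measurable_EFinP.
have prodE A : measurable A -> (distribution P X \x Q)%E A = distribution P XZ A.
  by apply: product_measure_unique => A' B mA mB; exact: uz.
have iXZ : (distribution P XZ).-integrable setT (EFin \o psi).
  exact: (integrable_pushforward (phi := XZ)).
have iprod : (distribution P X \x Q)%E.-integrable setT (EFin \o psi).
  apply/integrableP; split => //; have /integrableP[_ ioo] := iXZ.
  by rewrite (eq_measure_integral (distribution P XZ))// => A mA _; exact: prodE.
transitivity (\int[distribution P XZ]_p (EFin \o psi) p)%E.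
  by rewrite integral_distribution.
rewrite (eq_measure_integral (distribution P X \x Q)%E); last first.
  by move=> A mA _; exact/esym/prodE.
rewrite -integral12_prod_meas1//; apply: integral0_eq => a _.
exact: psi0.
Qed.

(** For fixed [C], both sides are measures in [D] that agree on rectangles. *)
Lemma indep_pair (d1 d2 : measure_display) (U : measurableType d1)
    (S : measurableType d2) (Q : probability S R) (u : T -> U) (y z : T -> S) :
  measurable_fun setT u -> measurable_fun setT y -> measurable_fun setT z ->
  (forall A B C, measurable A -> measurable B -> measurable C ->
     P (u @^-1` A `&` y @^-1` B `&` z @^-1` C) = (P (u @^-1` A) * Q B * Q C)%E) ->
  forall D C, measurable D -> measurable C ->
  P ((fun w => (u w, y w)) @^-1` D `&` z @^-1` C) =
  (P ((fun w => (u w, y w)) @^-1` D) * Q C)%E.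
Proof.
move=> mu my mz ind D C mD mC.
have muy : measurable_fun setT (fun w => (u w, y w)) by exact: measurable_fun_pair.
pose X : {mfun T >-> U} := HB.pack u (isMeasurableFun.Build _ _ _ _ u mu).
pose XY : {mfun T >-> (U * S)%type} :=
  HB.pack (fun w => (u w, y w)) (isMeasurableFun.Build _ _ _ _ _ muy).
have mzC : measurable (z @^-1` C) by rewrite -[X in measurable X]setTI; exact: mz.
have QC0 : 0 <= fine (Q C) by exact: fine_ge0.
have QCE : ((NngNum QC0)%:num)%:E = Q C by rewrite /= fineK// fin_num_measure.
pose Qs := mscale (NngNum QC0) Q.
have E1 : (distribution P X \x Qs)%E D = mscale (NngNum QC0) (distribution P XY) D.
  apply: product_measure_unique => // A B mA mB.
  change (((NngNum QC0)%:num)%:E * P (u @^-1` A `&` y @^-1` B) =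
    P (u @^-1` A) * (((NngNum QC0)%:num)%:E * Q B))%E; rewrite QCE.
  have := ind A B setT mA mB measurableT.
  rewrite preimage_setT setIT probability_setT mule1.
  by move=> ->; rewrite muleCA.
pose m' := pushforward (mrestr P mzC) XY.
have E2 : (distribution P X \x Qs)%E D = m' D.
  apply: product_measure_unique => // A B mA mB.
  change (P (u @^-1` A `&` y @^-1` B `&` z @^-1` C) =
    P (u @^-1` A) * (((NngNum QC0)%:num)%:E * Q B))%E; rewrite QCE.
  by rewrite ind// -muleA [(Q B * _)%E]muleC.
rewrite muleC -QCE; exact: etrans (esym E2) E1.
Qed.

End independence.

(** * Calculus of integrable real functions under a probability *)

Section real_integrals.
Context {R : realType} {d0 : measure_display} {T : measurableType d0}.
Variable P : probability T R.
Implicit Types (f g : T -> R) (A : set T).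

Notation L1 f := (P.-integrable setT (EFin \o f)).

Lemma L1_measurable f : L1 f -> measurable_fun setT f.
Proof. by move=> /integrableP[/measurable_EFinP]. Qed.

Lemma L1D f g : L1 f -> L1 g -> L1 (fun w => f w + g w).
Proof. by move=> lf lg; exact: (integrableD measurableT lf lg). Qed.

Lemma L1Z c f : L1 f -> L1 (fun w => c * f w).
Proof. by move=> lf; exact: (integrableZl measurableT c lf). Qed.

Lemma L1B f g : L1 f -> L1 g -> L1 (fun w => f w - g w).
Proof. by move=> lf lg; exact: (integrableB measurableT lf lg). Qed.

Lemma L1_cst c : L1 (fun=> c).
Proof. exact: finite_measure_integrable_cst. Qed.

Lemma L1_sum (I : Type) (s : seq I) (f : I -> T -> R) :
  (forall i, L1 (f i)) -> L1 (fun w => \sum_(i <- s) f i w).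
Proof.
move=> lf; elim: s => [|i s IH].
  by under eq_fun do rewrite big_nil; exact: L1_cst.
by under eq_fun do rewrite big_cons; exact: L1D.
Qed.

Lemma L1_le f g : measurable_fun setT f -> (forall w, `|f w| <= g w) ->
  L1 g -> L1 f.
Proof.
move=> mf fg; apply: le_integrable => //; first exact/measurable_EFinP.
by move=> w _ /=; rewrite lee_fin (le_trans (fg w))// ler_norm.
Qed.

Lemma L1_ge0_lty f : measurable_fun setT f -> (forall w, 0 <= f w) ->
  (\int[P]_w (f w)%:E < +oo)%E -> L1 f.
Proof.
move=> mf f0 fy; apply/integrableP; split; first exact/measurable_EFinP.
by under eq_integral do rewrite /= ger0_norm//.
Qed.

Lemma L1_EFin A f : measurable A -> L1 f ->
  (\int[P]_(w in A) (f w)%:E = (\int[P]_(w in A) f w)%:E)%E.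
Proof.
move=> mA lf; rewrite /Rintegral fineK//; apply: integrable_fin_num => //.
exact: integrableS lf.
Qed.

Lemma L1_RintegralD A f g : measurable A -> L1 f -> L1 g ->
  \int[P]_(w in A) (f w + g w) = \int[P]_(w in A) f w + \int[P]_(w in A) g w.
Proof. by move=> mA lf lg; apply: RintegralD => //; [exact: integrableS lf|exact: integrableS lg]. Qed.

Lemma L1_RintegralB A f g : measurable A -> L1 f -> L1 g ->
  \int[P]_(w in A) (f w - g w) = \int[P]_(w in A) f w - \int[P]_(w in A) g w.
Proof. by move=> mA lf lg; apply: RintegralB => //; [exact: integrableS lf|exact: integrableS lg]. Qed.

Lemma L1_RintegralZl A c f : measurable A -> L1 f ->
  \int[P]_(w in A) (c * f w) = c * \int[P]_(w in A) f w.
Proof. by move=> mA lf; apply: RintegralZl => //; exact: integrableS lf. Qed.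

Lemma L1_le_Rintegral A f g : measurable A -> L1 f -> L1 g ->
  (forall w, A w -> f w <= g w) -> \int[P]_(w in A) f w <= \int[P]_(w in A) g w.
Proof. by move=> mA lf lg; apply: le_Rintegral => //; [exact: integrableS lf|exact: integrableS lg]. Qed.

Lemma L1_Rintegral_sum A (I : Type) (s : seq I) (f : I -> T -> R) :
  measurable A -> (forall i, L1 (f i)) ->
  \int[P]_(w in A) (\sum_(i <- s) f i w) = \sum_(i <- s) \int[P]_(w in A) f i w.
Proof.
move=> mA lf; elim: s => [|i s IH].
  by under eq_Rintegral do rewrite big_nil; rewrite big_nil Rintegral_cst// mul0r.
under eq_Rintegral do rewrite big_cons.
by rewrite big_cons L1_RintegralD// ?IH//; exact: L1_sum.
Qed.

End real_integrals.

(** * Jensen's inequality for the square, over sets of the sub-sigma-algebra *)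

Section conditional_jensen.
Context {R : realType} {d0 : measure_display} {T : measurableType d0}.
Variables (P : probability T R) (gen : set (set T)).
Hypothesis genT : <<s gen >> `<=` measurable.
Variables X Y : T -> R.
Hypotheses (lX : P.-integrable setT (EFin \o (fun w => X w ^+ 2))).
Hypotheses (mX : measurable_fun setT X) (XY : is_cond_exp P <<s gen >> X Y).

Let lX1 : P.-integrable setT (EFin \o X).
Proof.
apply: (L1_le (g := fun w => 1 + X w ^+ 2)) => //.
  by move=> w; rewrite ler_norml; apply/andP; split; nra.
by apply: L1D => //; exact: L1_cst.
Qed.

(* On the cell {q <= Y < q + e} the tangent line 2qY - q^2 is within e^2 of Y^2
   and, being linear in Y, has the same integral as 2qX - q^2 <= X^2. *)
Lemma cond_jensen_cell D (q e : R) : <<s gen >> D -> 0 < e ->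
  (forall w, D w -> q <= Y w < q + e) ->
  (\int[P]_(w in D) (Y w ^+ 2)%:E <= \int[P]_(w in D) (X w ^+ 2 + e ^+ 2)%:E)%E.
Proof.
move=> GD e0 DY; have mD := genT GD; have [_ [lY EY]] := XY.
have mYT : measurable_fun setT Y by exact: L1_measurable lY.
have lin Z : P.-integrable setT (EFin \o Z) ->
    P.-integrable setT (EFin \o (fun w => 2 * q * Z w + (e ^+ 2 - q ^+ 2))).
  by move=> lZ; apply: L1D; [exact: L1Z|exact: L1_cst].
apply: (@le_trans _ _ (\int[P]_(w in D) (2 * q * Y w + (e ^+ 2 - q ^+ 2))%:E)%E).
  apply: ge0_le_integral => //.
  - by move=> w _; rewrite lee_fin sqr_ge0.
  - apply: measurable_funTS; apply/measurable_EFinP; exact: measurable_funX.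
  - apply: measurable_funTS; apply/measurable_EFinP; exact: L1_measurable (lin _ lY).
  - by move=> w /DY /andP[h1 h2]; rewrite lee_fin; nra.
rewrite !L1_EFin//; [|by apply: L1D => //; exact: L1_cst|exact: lin].
have XYD : \int[P]_(w in D) Y w = \int[P]_(w in D) X w by rewrite /Rintegral EY.
have linE Z : P.-integrable setT (EFin \o Z) ->
    \int[P]_(w in D) (2 * q * Z w + (e ^+ 2 - q ^+ 2)) =
    2 * q * \int[P]_(w in D) Z w + \int[P]_(w in D) (e ^+ 2 - q ^+ 2).
  by move=> lZ; rewrite L1_RintegralD// ?L1_RintegralZl//; [exact: L1Z|exact: L1_cst].
rewrite linE// XYD -linE// lee_fin; apply: L1_le_Rintegral => //.
- exact: lin.
- by apply: L1D => //; exact: L1_cst.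
- by move=> w _; have := sqr_ge0 (X w - q); nra.
Qed.

(** The values of [Y] are cut into cells of width [e]; the cell errors add up to at most [e ^+ 2].
    The inequality is between extended reals because [Y ^+ 2] is not known to be integrable; that is
    deduced from it. *)
Lemma cond_jensen A : <<s gen >> A ->
  (\int[P]_(w in A) (Y w ^+ 2)%:E <= \int[P]_(w in A) (X w ^+ 2)%:E)%E.
Proof.
move=> GA; have mA := genT GA; have [mY [lY EY]] := XY.
have mYT : measurable_fun setT Y by exact: L1_measurable lY.
have mX2 : measurable_fun setT (fun w => (X w ^+ 2)%:E).
  by apply/measurable_EFinP; exact: measurable_funX.
have mY2 : measurable_fun setT (fun w => (Y w ^+ 2)%:E).
  by apply/measurable_EFinP; exact: measurable_funX.
apply/lee_addgt0Pr => e0 e00.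
pose e := Num.min 1 e0; have e_gt0 : 0 < e by rewrite lt_min ltr01.
have ee0 : e ^+ 2 <= e0.
  have e1 : e <= 1 by rewrite ge_min lexx.
  have : e <= e0 by rewrite ge_min lexx orbT.
  by apply: le_trans; rewrite expr2 ler_piMl// ltW.
pose cell (m : int) := [set w | Num.floor (Y w / e) = m].
(* The cells are indexed by integers and enumerated by [unpickle]; the test on [pickle m] keeps one
   index per cell, so the pieces are disjoint. *)
pose B n := A `&` (if @unpickle int n is Some m then
                     (if pickle m == n then cell m else set0) else set0).
have Gcell m : <<s gen >> (cell m).
  have -> : cell m = Y @^-1` [set` `[m%:~R * e, (m + 1)%:~R * e[].
    apply/seteqP; split => w /=; rewrite in_itv /=.
      move=> <-; have /andP[h1 h2] := floor_itv (Y w / e).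
      by rewrite -ler_pdivlMr// h1 -ltr_pdivrMr.
    rewrite -ler_pdivlMr// -ltr_pdivrMr//; exact: floor_def.
  exact: mY.
have GB n : <<s gen >> (B n).
  pose T' := g_sigma_algebraType gen.
  suff : measurable (B n : set T') by [].
  apply: measurableI; first exact: GA.
  case: (unpickle n) => [m|]; last exact: measurable0.
  by case: ifP => _; [exact: Gcell|exact: measurable0].
have mB n : measurable (B n) by exact: genT.
have AB : A = \bigcup_n B n.
  apply/seteqP; split => w; last by move=> [n _ []].
  move=> Aw; exists (pickle (Num.floor (Y w / e))); first by [].
  by split; [exact: Aw|rewrite pickleK eqxx].
have tB : trivIset setT B.
  apply/trivIsetP => i j _ _ ij; apply/seteqP; split => // w [[_ +] [_]].
  case: (unpickle i) => [m|]//; case: (unpickle j) => [m'|]//.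
  case: ifP => // /eqP mi; case: ifP => // /eqP mj /= c1 c2.
  by move: ij; rewrite -mi -mj -c1 -c2 eqxx.
apply: (@le_trans _ _ (\int[P]_(w in A) ((X w ^+ 2) + e ^+ 2)%:E)%E); last first.
  under eq_integral do rewrite EFinD.
  rewrite ge0_integralD//; [|by move=> w _; rewrite lee_fin sqr_ge0|
    exact: measurable_funTS|by move=> w _; rewrite lee_fin sqr_ge0].
  rewrite leeD2l// integral_cst//.
  apply: (@le_trans _ _ ((e ^+ 2)%:E * 1)%E); last by rewrite mule1 lee_fin.
  by rewrite lee_wpmul2l// ?lee_fin ?sqr_ge0// probability_le1.
rewrite AB !ge0_integral_bigcup//; first last.
- by move=> w _; rewrite lee_fin sqr_ge0.
- exact: measurable_funTS.
- by move=> w _; rewrite lee_fin addr_ge0// sqr_ge0.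
- apply: measurable_funTS; apply/measurable_EFinP; apply: measurable_funD => //.
  exact/measurable_EFinP.
apply: lee_nneseries => n _.
  by move=> _; apply: integral_ge0 => w _; rewrite lee_fin sqr_ge0.
have : B n = set0 \/ exists m, B n `<=` cell m.
  rewrite /B; case: (unpickle n) => [m|]; last by left; rewrite setI0.
  by case: ifP => _; [right; exists m; exact: subIsetr|left; rewrite setI0].
move=> [->|[m Bm]]; first by rewrite !integral_set0.
apply: (@cond_jensen_cell _ (m%:~R * e)) => // w /Bm cw.
have /andP[h1 h2] := floor_itv (Y w / e); rewrite cw in h1 h2.
rewrite -ler_pdivlMr// h1 /=.
by move: h2; rewrite intrD ltr_pdivrMr// mulrDl mul1r.
Qed.

End conditional_jensen.

(** * Variance of the sampled gradient *)

Section indep_cross.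
Context {R : realType} {d : nat} {d0 d1 : measure_display}.
Context {T : measurableType d0} {Xi : measurableType d1}.
Variables (P : probability T R) (Q : probability Xi R).
Variables (F : 'rV[R]_d -> Xi -> R) (GF : 'rV[R]_d -> Xi -> 'rV[R]_d).
Variable gradf : 'rV[R]_d -> 'rV[R]_d.
Hypothesis gF : forall s, has_gradient (F^~ s) (GF^~ s).
Hypothesis mF : forall y, measurable_fun setT (F y).
Hypothesis GFgradf : forall y (j : 'I_d),
  Q.-integrable setT (fun s => (GF y s ord0 j)%:E) /\
  (\int[Q]_s (GF y s ord0 j)%:E = (gradf y ord0 j)%:E)%E.
Hypothesis cgradf : continuous gradf.
Context {dG : measure_display} {G : measurableType dG}.
Variables (u : T -> G) (x : G -> 'rV[R]_d) (y z : T -> Xi) (A : set G).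

Let err v s := GF v s - gradf v.

(** With the history [u] and the sample [y] frozen, averaging over [z] alone kills the inner
    product, because the gradient is unbiased at every fixed point. *)
Lemma indep_cross : measurable_fun setT u -> mfunv x ->
  measurable_fun setT y -> measurable_fun setT z -> measurable A ->
  (forall A B C, measurable A -> measurable B -> measurable C ->
     P (u @^-1` A `&` y @^-1` B `&` z @^-1` C) = (P (u @^-1` A) * Q B * Q C)%E) ->
  P.-integrable setT (EFin \o
    (fun w => dotv (err (x (u w)) (y w)) (err (x (u w)) (z w)))) ->
  (\int[P]_w (\1_A (u w) *
      dotv (err (x (u w)) (y w)) (err (x (u w)) (z w)))%:E = 0)%E.
Proof.
move=> mu mx my mz mA ind lD.
pose psi (p : (G * Xi) * Xi) : R :=
  \1_A p.1.1 * dotv (err (x p.1.1) p.1.2) (err (x p.1.1) p.2).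
have mx11 : mfunv (fun p : (G * Xi) * Xi => x p.1.1).
  by move=> l; apply: (measurableT_comp (mx l)); apply: measurableT_comp.
have merr (S : (G * Xi) * Xi -> Xi) : measurable_fun setT S ->
    mfunv (fun p => err (x p.1.1) (S p)).
  move=> mS; apply: mfunvB; first exact: (gradient_measurable gF mF mx11 mS).
  exact: (continuous_comp_mfunv cgradf mx11).
apply: (@indep_integral_eq0 _ _ _ P _ _ (G * Xi)%type Xi Q
    (fun w => (u w, y w)) z psi) => //.
- exact: measurable_fun_pair.
- exact: indep_pair.
- apply: measurable_funM.
    apply: (@measurableT_comp _ _ _ _ _ _ (\1_A : G -> R)) => //.
    by apply: measurableT_comp.
  by apply: measurable_dotv; apply: merr => //; apply: measurableT_comp.
- apply: L1_le (integrable_norm lD).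
  + apply: measurable_funM; last exact: L1_measurable lD.
    exact: (@measurableT_comp _ _ _ _ _ _ (\1_A : G -> R)).
  + move=> w; rewrite /psi normrM ler_piMl// indicE.
    by case: (u w \in A); rewrite ?normr1 ?normr0.
- move=> [w s]; rewrite /psi /=.
  have lGF l : Q.-integrable setT (EFin \o (fun s' => err (x w) s' ord0 l)).
    have [lG _] := GFgradf (x w) l.
    have := L1B lG (L1_cst Q (gradf (x w) ord0 l)).
    by apply: eq_integrable => // s' _; rewrite /= !mxE.
  rewrite L1_EFin//; last by apply: L1Z; apply: L1_sum => l; exact: L1Z.
  rewrite L1_RintegralZl//; last by apply: L1_sum => l; exact: L1Z.
  rewrite L1_Rintegral_sum => [||l]//; last exact: L1Z.
  rewrite big1 ?mulr0// => l _; rewrite L1_RintegralZl//.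
  have [lG eG] := GFgradf (x w) l.
  under eq_Rintegral do rewrite !mxE.
  rewrite L1_RintegralB//; last exact: L1_cst.
  have Q1 : fine (Q setT) = 1 by rewrite probability_setT.
  by rewrite Rintegral_cst// Q1 mulr1 /Rintegral eG subrr mulr0.
Qed.

End indep_cross.

(** * Sample averages of random, history-dependent size *)

Section sampling.
Context {R : realType} {d : nat} {d0 d1 : measure_display}.
Context {T : measurableType d0} {Xi : measurableType d1}.
Variables (P : probability T R) (Q : probability Xi R).
Variables (F : 'rV[R]_d -> Xi -> R) (GF : 'rV[R]_d -> Xi -> 'rV[R]_d).
Variables (gradf : 'rV[R]_d -> 'rV[R]_d) (sigma : R).
Variables (gen : set (set T)) (x : T -> 'rV[R]_d) (xi : nat -> T -> Xi).
Hypothesis genT : <<s gen >> `<=` measurable.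
Hypothesis gF : forall s, has_gradient (F^~ s) (GF^~ s).
Hypothesis mF : forall y, measurable_fun setT (F y).
Hypothesis GFgradf : forall y (j : 'I_d),
  Q.-integrable setT (fun s => (GF y s ord0 j)%:E) /\
  (\int[Q]_s (GF y s ord0 j)%:E = (gradf y ord0 j)%:E)%E.
Hypothesis cgradf : continuous gradf.
Hypothesis xG : @mfunv R d _ (g_sigma_algebraType gen) x.
Hypothesis xi_law : forall i, has_law P Q (xi i).
Hypothesis xi_indep : mut_indep P (fun o : option nat =>
  match o with None => <<s gen >> | Some i => sigma_of (xi i) end).

Let T' : measurableType _ := g_sigma_algebraType gen.

Definition noise i w := GF (x w) (xi i w) - gradf (x w).

Hypothesis noise_var : forall i A, <<s gen >> A ->
  (\int[P]_(w in A) (nrm2 (noise i w))%:E <= (sigma ^+ 2)%:E * P A)%E.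

Notation L1 f := (P.-integrable setT (EFin \o f)).

Lemma sub_measurable_fun (u : T -> R) :
  measurable_fun (setT : set T') u -> measurable_fun setT u.
Proof.
move=> mu _ B mB; rewrite setTI; apply: genT.
by have := mu measurableT B mB; rewrite setTI.
Qed.

Lemma sub_mfunv (Y : T -> 'rV[R]_d) : @mfunv R d _ T' Y -> mfunv Y.
Proof. by move=> mY j; exact: sub_measurable_fun. Qed.

Lemma noise_mfunv i : mfunv (noise i).
Proof.
have mx := sub_mfunv xG; have [mxi _] := xi_law i.
apply: mfunvB; first exact: (gradient_measurable gF).
exact: continuous_comp_mfunv.
Qed.

Lemma noise_L2 i : L1 (fun w => nrm2 (noise i w)).
Proof.
apply: L1_ge0_lty => [||].
- by apply: measurable_nrm2; exact: noise_mfunv.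
- by move=> w; exact: nrm2_ge0.
- have GT : <<s gen >> setT by have := @measurableT _ T'.
  by apply: (le_lt_trans (noise_var i GT)); rewrite probability_setT mule1 ltry.
Qed.

Lemma dotv_L1 (Y Z : T -> 'rV[R]_d) : mfunv Y -> mfunv Z ->
  L1 (fun w => nrm2 (Y w)) -> L1 (fun w => nrm2 (Z w)) ->
  L1 (fun w => dotv (Y w) (Z w)).
Proof.
move=> mY mZ lY lZ; apply: (L1_le (g := fun w => nrm2 (Y w) + nrm2 (Z w))).
- exact: measurable_dotv.
- move=> w; rewrite ler_norml; apply/andP; split.
    have := nrm2_ge0 (Y w + Z w); rewrite nrm2D.
    by have := nrm2_ge0 (Y w); have := nrm2_ge0 (Z w); lra.
  have := nrm2_ge0 (Y w - Z w); rewrite nrm2D nrm2N dotvNr.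
  by have := nrm2_ge0 (Y w); have := nrm2_ge0 (Z w); lra.
- exact: L1D.
Qed.

Lemma xi_indep3 i j A B C : i != j -> <<s gen >> A -> measurable B ->
  measurable C ->
  P (A `&` xi i @^-1` B `&` xi j @^-1` C) = (P A * Q B * Q C)%E.
Proof.
move=> ij GA mB mC; have [mi Pi] := xi_law i; have [mj Pj] := xi_law j.
pose E o := match o with None => A
  | Some k => if k == i then xi i @^-1` B else xi j @^-1` C end.
have mpre k D : measurable D -> measurable (xi k @^-1` D).
  by move=> mD; rewrite -[X in measurable X]setTI; have [+ _] := xi_law k; exact.
have := xi_indep (s := [:: None; Some i; Some j]) (A := E).
rewrite !big_cons big_nil mulr1 /= eqxx (negbTE (negbT (_ : (j == i) = false))); last first.
  by rewrite eq_sym (negbTE ij).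
have -> : \bigcap_(o in [set o | o \in [:: None; Some i; Some j]]) E o =
    A `&` xi i @^-1` B `&` xi j @^-1` C.
  apply/seteqP; split => w /=.
    move=> H; split; first split.
    - by apply: (H None) => /=; rewrite inE.
    - by have := H (Some i); rewrite /E eqxx; apply; rewrite /= !inE eqxx orbT.
    - have := H (Some j); rewrite /E eq_sym (negbTE ij); apply.
      by rewrite /= !inE eqxx !orbT.
  move=> [[Aw Bw] Cw] o /=; rewrite !inE => /or3P[] /eqP -> //=.
    by rewrite eqxx.
  by rewrite eq_sym (negbTE ij).
move=> H; have {}H : fine (P (A `&` xi i @^-1` B `&` xi j @^-1` C)) =
    fine (P A) * (fine (Q B) * fine (Q C)).
  rewrite -Pi// -Pj//; apply: H.
    by rewrite /= !inE /= andbT; apply/eqP => -[] /eqP; exact/negP.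
  move=> o; rewrite !inE => /or3P[] /eqP -> //=.
    by rewrite eqxx; exists B.
  by rewrite eq_sym (negbTE ij); exists C.
have fP D : measurable D -> P D \is a fin_num by move=> ?; exact: fin_num_measure.
rewrite -[LHS]fineK; last first.
  by apply: fP; apply: measurableI; [apply: measurableI|]; auto.
rewrite H !EFinM !fineK ?muleA//; try exact: fin_num_measure.
by apply: fP; exact: genT.
Qed.

Lemma noise_cross i j A : i != j -> <<s gen >> A ->
  \int[P]_(w in A) dotv (noise i w) (noise j w) = 0.
Proof.
move=> ij GA; have mA := genT GA.
have [mi _] := xi_law i; have [mj _] := xi_law j.
(* The identity, read as a map into [T] with the coarser sigma-algebra, is the history variable of
   [indep_cross]. *)
have mid : measurable_fun setT (id : T -> T').
  by move=> _ B mB; rewrite setTI; exact: genT.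
have lD : L1 (fun w => dotv (noise i w) (noise j w)).
  by apply: dotv_L1; [exact: noise_mfunv|exact: noise_mfunv|exact: noise_L2|exact: noise_L2].
have E := @indep_cross _ _ _ _ _ _ P Q F GF gradf gF mF GFgradf cgradf
  _ T' id x (xi i) (xi j) A mid xG mi mj GA.
rewrite /Rintegral integral_mkcond.
rewrite (_ : (fun w => _) \_ A = (fun w => (\1_A w *
    dotv (noise i w) (noise j w))%:E)) ?E//.
  by move=> A' B C mA' mB mC; exact: xi_indep3.
by apply/funext => w; rewrite /patch indicE; case: (w \in A); rewrite ?mul1r ?mul0r.
Qed.

Lemma noise_sum_L2 n : L1 (fun w => nrm2 (\sum_(i < n) noise i w)) /\
  mfunv (fun w => \sum_(i < n) noise i w).
Proof.
elim: n => [|n [IH mIH]].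
  split; under eq_fun do rewrite big_ord0; last by move=> j; exact: measurable_cst.
  by under eq_fun do rewrite nrm20; exact: L1_cst.
split; under eq_fun do rewrite big_ord_recr /=.
  under eq_fun do rewrite nrm2D.
  apply: L1D; last exact: noise_L2.
  apply: L1D => //; apply: L1Z; apply: dotv_L1 => //; first exact: noise_mfunv.
  exact: noise_L2.
by apply: mfunvD => //; exact: noise_mfunv.
Qed.

Lemma noise_sum_var n A : <<s gen >> A ->
  \int[P]_(w in A) nrm2 (\sum_(i < n) noise i w) <= n%:R * sigma ^+ 2 * fine (P A).
Proof.
move=> GA; have mA := genT GA; elim: n => [|n IH].
  by under eq_Rintegral do rewrite big_ord0 nrm20; rewrite Rintegral_cst// !mul0r.
have [lS mS] := noise_sum_L2 n.
have lSn : L1 (fun w => dotv (\sum_(i < n) noise i w) (noise n w)).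
  by apply: dotv_L1 => //; [exact: noise_mfunv|exact: noise_L2].
under eq_Rintegral do rewrite big_ord_recr /= nrm2D.
rewrite L1_RintegralD//; [|by apply: L1D => //; exact: L1Z|exact: noise_L2].
rewrite L1_RintegralD//; last exact: L1Z.
rewrite L1_RintegralZl//.
have -> : \int[P]_(w in A) dotv (\sum_(i < n) noise i w) (noise n w) = 0.
  have dE w : dotv (\sum_(i < n) noise i w) (noise n w) =
      \sum_(i < n) dotv (noise i w) (noise n w).
    elim/big_rec2: _ => [|i u v _ <-]; last by rewrite dotvDl.
    by rewrite -(scale0r 0) dotvZl mul0r.
  under eq_Rintegral do rewrite dE.
  rewrite L1_Rintegral_sum//; last first.
    by move=> i; apply: dotv_L1; [exact: noise_mfunv|exact: noise_mfunv|exact: noise_L2|exact: noise_L2].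
  by rewrite big1// => i _; rewrite noise_cross// neq_ltn ltn_ord.
have H : \int[P]_(w in A) nrm2 (noise n w) <= sigma ^+ 2 * fine (P A).
  rewrite -lee_fin -L1_EFin//; last exact: noise_L2.
  by rewrite EFinM fineK ?noise_var// fin_num_measure.
by rewrite mulr0 addr0 -natr1 2!mulrDl mul1r lerD.
Qed.

Variables (N : T -> nat).
Hypothesis N_gt0 : forall w, (0 < N w)%N.
Hypothesis mN : forall n, <<s gen >> [set w | N w = n].

Definition sampled w := (N w)%:R^-1 *: \sum_(i < N w) GF (x w) (xi i w).

Lemma sampled_error w :
  sampled w - gradf (x w) = (N w)%:R^-1 *: \sum_(i < N w) noise i w.
Proof.
rewrite /sampled /noise sumrB scalerBr sumr_const card_ord -[gradf _ *+ _]scaler_nat scalerA.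
by rewrite mulVf ?scale1r// pnatr_eq0 -lt0n.
Qed.

Lemma measurable_N_cases (u : nat -> T -> R) :
  (forall n, measurable_fun setT (u n)) ->
  measurable_fun setT (fun w => u (N w) w).
Proof.
move=> mu _ B mB; rewrite setTI.
have -> : (fun w => u (N w) w) @^-1` B =
    \bigcup_n ([set w | N w = n] `&` (setT `&` u n @^-1` B)).
  apply/seteqP; split => w /=; first by move=> uB; exists (N w).
  by move=> [n _ [<- []]].
apply: bigcupT_measurable => n; apply: measurableI; first exact: genT.
exact: mu.
Qed.

Lemma sampled_mfunv : mfunv sampled.
Proof.
move=> j.
pose u n w := n%:R^-1 * \sum_(i < n) GF (x w) (xi i w) ord0 j.
have -> : (fun w => sampled w ord0 j) = (fun w => u (N w) w).
  by apply/funext => w; rewrite mxE summxE.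
apply: (@measurable_N_cases u) => n; apply: measurable_funM => //.
apply: measurable_sum => i; have [mi _] := xi_law i.
by apply: (gradient_measurable gF) => //; exact: sub_mfunv.
Qed.

(** Since the sample size is itself known from the history, [A] splits into pieces of [G] on which
    it is a constant [n]; there the variance of the sum, at most [n%:R * sigma ^+ 2], is divided by
    [n ^ 2]. *)
Lemma sampled_var A : <<s gen >> A ->
  (\int[P]_(w in A) (nrm2 (sampled w - gradf (x w)))%:E <=
   \int[P]_(w in A) (sigma ^+ 2 / (N w)%:R)%:E)%E.
Proof.
move=> GA; have mA := genT GA.
pose B n := A `&` [set w | N w = n].
have GB n : <<s gen >> (B n).
  by apply: (@measurableI _ T'); [exact: GA|exact: mN].
have mB n : measurable (B n) by exact: genT.
have AB : A = \bigcup_n B n.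
  apply/seteqP; split => w; last by move=> [n _ []].
  by move=> Aw; exists (N w).
have tB : trivIset setT B.
  apply/trivIsetP => i j _ _ ij; apply/seteqP; split => // w [[_ /= Ei] [_ /= Ej]].
  by move: ij; rewrite -Ei -Ej eqxx.
have me : measurable_fun setT (fun w => (nrm2 (sampled w - gradf (x w)))%:E).
  apply/measurable_EFinP; apply: measurable_nrm2; apply: mfunvB.
    exact: sampled_mfunv.
  by apply: continuous_comp_mfunv => //; exact: sub_mfunv.
have ms : measurable_fun setT (fun w => (sigma ^+ 2 / (N w)%:R)%:E).
  apply/measurable_EFinP.
  exact: (@measurable_N_cases (fun n _ => sigma ^+ 2 / n%:R)).
rewrite AB !ge0_integral_bigcup//; first last.
- by move=> w _; rewrite lee_fin nrm2_ge0.
- exact: measurable_funTS.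
- by move=> w _; rewrite lee_fin divr_ge0// sqr_ge0.
- exact: measurable_funTS.
apply: lee_nneseries => n _.
  by move=> _; apply: integral_ge0 => w _; rewrite lee_fin nrm2_ge0.
have [n0|n_gt0] := posnP n.
  have -> : B n = set0.
    apply/seteqP; split => // w [_ /= Nw].
    by have := N_gt0 w; rewrite Nw n0.
  by rewrite !integral_set0.
under eq_integral => w.
  rewrite inE => -[_ /= Nw]; rewrite sampled_error Nw nrm2Z; over.
under [leRHS]eq_integral => w.
  rewrite inE => -[_ /= Nw]; rewrite Nw; over.
have [lS _] := noise_sum_L2 n.
rewrite L1_EFin//; last exact: L1Z.
rewrite L1_EFin//; last exact: L1_cst.
rewrite L1_RintegralZl// Rintegral_cst// lee_fin.
apply: (le_trans (ler_wpM2l (sqr_ge0 _) (noise_sum_var n (GB n)))).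
rewrite le_eqVlt; apply/orP; left; apply/eqP; field.
by rewrite pnatr_eq0 -lt0n.
Qed.

End sampling.

(** * Passing between integral and almost sure inequalities *)

Section conditional_expectation.
Context {R : realType} {d : nat} {d0 : measure_display} {T : measurableType d0}.
Variables (P : probability T R) (gen : set (set T)).
Hypothesis genT : <<s gen >> `<=` measurable.

Let T' : measurableType _ := g_sigma_algebraType gen.

Notation L1 f := (P.-integrable setT (EFin \o f)).

Lemma G_measurableE (Y : T -> R) :
  G_measurable <<s gen >> Y <-> measurable_fun (setT : set T') Y.
Proof.
split => [mY _ B mB|mY B mB]; first by rewrite setTI; exact: mY.
by have := mY measurableT B mB; rewrite setTI.
Qed.

Lemma cond_expv_jensen (X Y : T -> 'rV[R]_d) :
  mfunv X -> L1 (fun w => nrm2 (X w)) -> is_cond_expv P <<s gen >> X Y ->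
  L1 (fun w => nrm2 (Y w)) /\ forall A, <<s gen >> A ->
    \int[P]_(w in A) nrm2 (Y w) <= \int[P]_(w in A) nrm2 (X w).
Proof.
move=> mX lX XY.
have lXj j : L1 (fun w => X w ord0 j ^+ 2).
  apply: L1_le lX; first by apply: measurable_funX; exact: mX.
  by move=> w; rewrite ger0_norm ?sqr_ge0// sqr_coord_le.
have lYj j : L1 (fun w => Y w ord0 j ^+ 2).
  have [mY [lY _]] := XY j; apply: L1_ge0_lty.
  - by apply: measurable_funX; exact: L1_measurable lY.
  - by move=> w; exact: sqr_ge0.
  - have GT : <<s gen >> setT by have := @measurableT _ T'.
    apply: (le_lt_trans (cond_jensen genT (lXj j) (mX j) (XY j) GT)).
    by rewrite L1_EFin// ltry.
have nE (Z : T -> 'rV[R]_d) : (fun w => nrm2 (Z w)) =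
    (fun w => \sum_(j < d) Z w ord0 j ^+ 2).
  by apply/funext => w; apply: eq_bigr => j _; rewrite expr2.
split; first by rewrite nE; exact: L1_sum.
move=> A GA; have mA := genT GA.
rewrite (nE X) (nE Y) !L1_Rintegral_sum//; apply: ler_sum => j _.
by rewrite -lee_fin -!L1_EFin//; exact: (cond_jensen genT).
Qed.

Lemma is_cond_expB (X Y Z : T -> R) : L1 X -> L1 Z ->
  measurable_fun (setT : set T') Z -> is_cond_exp P <<s gen >> X Y ->
  is_cond_exp P <<s gen >> (fun w => X w - Z w) (fun w => Y w - Z w).
Proof.
move=> lX lZ mZ [mY [lY EY]]; split; [|split].
- by apply/G_measurableE; apply: measurable_funB => //; apply/G_measurableE.
- exact: L1B.
- move=> A GA; have mA := genT GA.
  rewrite !L1_EFin//; [|exact: L1B|exact: L1B].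
  by rewrite !L1_RintegralB//; congr (_ - _)%:E; rewrite /Rintegral EY.
Qed.

(** On [A], where [U] exceeds [V], the integral of [U - V] is both nonnegative and nonpositive, so
    this positive function vanishes almost everywhere on [A]. *)
Lemma ae_le_of_Rintegral (U V : T -> R) : L1 U -> L1 V ->
  measurable_fun (setT : set T') U -> measurable_fun (setT : set T') V ->
  (forall A, <<s gen >> A -> \int[P]_(w in A) U w <= \int[P]_(w in A) V w) ->
  {ae P, forall w, U w <= V w}.
Proof.
move=> lU lV mU mV UV.
pose A := [set w | 0 < U w - V w].
have GA : <<s gen >> A.
  have -> : A = (fun w => U w - V w) @^-1` [set` `]0, +oo[].
    by apply/seteqP; split => w /=; rewrite in_itv /= andbT.
  have : G_measurable <<s gen >> (fun w => U w - V w).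
    by apply/G_measurableE; exact: measurable_funB.
  by apply; exact: measurable_itv.
have mA := genT GA; have lUV := L1B lU lV.
have E : (\int[P]_(w in A) `|(U w - V w)%:E| = 0)%E.
  under eq_integral => w.
    by rewrite inE => Aw; rewrite gee0_abs ?lee_fin ?ltW//; over.
  rewrite L1_EFin//; apply/eqP; rewrite eqe; apply/eqP/le_anti/andP; split.
    by rewrite L1_RintegralB// subr_le0 UV.
  by apply: Rintegral_ge0 => w; rewrite /A /=; exact: ltW.
have mUV : measurable_fun A (fun w => (U w - V w)%:E).
  by apply: measurable_funTS; apply/measurable_EFinP; exact: L1_measurable lUV.
have /(ae_eq_integral_abs P mA mUV) := E.
apply: filterS => w /=; rewrite /A /= => H; rewrite leNgt; apply/negP => VU.
have VU' : 0 < U w - V w by rewrite subr_gt0.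
by have [H'] := H VU'; move: VU'; rewrite H' ltxx.
Qed.

(** Puts Assumption V in integrated form. The version [Y] is bounded only almost surely, so it is
    replaced by [Num.min (Y w) c], which is bounded everywhere. *)
Lemma cond_exp_le (X Y : T -> R) c : is_cond_exp P <<s gen >> X Y ->
  {ae P, forall w, Y w <= c} -> forall A, <<s gen >> A ->
  (\int[P]_(w in A) (X w)%:E <= c%:E * P A)%E.
Proof.
move=> [_ [lY EY]] Yc A GA; have mA := genT GA; rewrite -EY//.
have mY := L1_measurable lY.
have mYc : measurable_fun setT (fun w => Num.min (Y w) c).
  by apply: measurable_minr.
have lYc : L1 (fun w => Num.min (Y w) c).
  apply: (L1_le (g := fun w => `|Y w| + `|c|)) => //.
    move=> w; rewrite /Order.min; case: ifP => _.
      by rewrite lerDl.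
    by rewrite lerDr.
  by apply: L1D; [exact: integrable_norm|exact: L1_cst].
rewrite (@ae_eq_integral _ _ _ _ _ (fun w => (Num.min (Y w) c)%:E))//.
- rewrite L1_EFin// -[P A]fineK ?fin_num_measure// -EFinM lee_fin.
  rewrite -Rintegral_cst//; apply: L1_le_Rintegral => //; first exact: L1_cst.
  by move=> w _; rewrite ge_min lexx orbT.
- by apply: measurable_funTS; exact/measurable_EFinP.
- by apply: measurable_funTS; exact/measurable_EFinP.
- by apply: filterS Yc => w Yw _; rewrite min_l.
Qed.

End conditional_expectation.

(** Multiplying out, the event reads [(m - 1) * u < c <= m * u], which involves no quotient. *)
Lemma measurable_ceil_div {R : realType} {d0 : measure_display}
    {T : measurableType d0} (c : R) (u : T -> R) (m : int) :
  measurable_fun setT u -> (forall w, 0 < u w) ->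
  measurable [set w | Num.ceil (c / u w) = m].
Proof.
move=> mu u0.
have -> : [set w | Num.ceil (c / u w) = m] =
    (setT `&` (fun w => c - (m - 1)%:~R * u w) @^-1` [set` `]0, +oo[]) `&`
    (setT `&` (fun w => m%:~R * u w - c) @^-1` [set` `[0, +oo[]).
  rewrite !setTI; apply/seteqP; split => w /=; rewrite !in_itv /= !andbT.
    move=> <-; have /andP[h1 h2] := ceil_itv (c / u w).
    by rewrite subr_gt0 -ltr_pdivlMr// h1 subr_ge0 -ler_pdivrMr.
  move=> [h1 h2]; apply: ceil_def.
  by rewrite ltr_pdivlMr// -subr_gt0 h1 ler_pdivrMr// -subr_ge0.
apply: measurableI.
- by apply: measurable_funB => //; exact: measurable_funM.
- by apply: measurable_funB => //; exact: measurable_funM.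
Qed.

(** * From summability to complexity *)

Section summation.
Context {R : realType} {d0 : measure_display} {T : measurableType d0}.
Variable P : probability T R.
Variables (E2 R2 T2 : nat -> T -> R) (delta : nat -> R) (eta iota0 a A B D : R).
Notation L1 f := (P.-integrable setT (EFin \o f)).
Hypotheses (lE : forall k, L1 (E2 k)) (lR : forall k, L1 (R2 k)).
Hypothesis lT : forall k, L1 (T2 k).
Hypothesis R0 : forall k w, 0 <= R2 k w.
Hypotheses (eta01 : 0 < eta < 1) (a0 : 0 < a).
Hypothesis TER : forall k w, T2 k w <= 2 * (E2 k w + R2 k w).
Hypothesis condC : forall k,
  \int[P]_w E2 k w <= eta ^+ 2 / 4 * \int[P]_w R2 k w + iota0 ^+ 2 * delta k ^+ 2.
Hypothesis path_descent : forall K w,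
  \sum_(k < K) (a * (3 / 4) * R2 k.+1 w - a / eta * E2 k.+1 w) <= A + B * E2 0%N w.
Hypothesis sum_delta : forall K, \sum_(k < K) delta k.+1 ^+ 2 <= D.

(** [E2], [R2] and [T2] stand for the squared error, residual and true residual. In expectation,
    Condition C turns the error term into at most [a / 4] times the residual plus a summable term,
    leaving [3 / 4 - 1 / 4 = 1 / 2] of the descent. *)
Lemma sum_expected_residual : exists C, forall K,
  \sum_(k < K) \int[P]_w T2 k.+1 w <= C.
Proof.
have /andP[eta0 eta1] := eta01.
pose C0 := A + B * \int[P]_w E2 0%N w.
pose S K := \sum_(k < K) \int[P]_w R2 k.+1 w.
pose Dl K := \sum_(k < K) delta k.+1 ^+ 2.
have P1 : fine (P setT) = 1 by rewrite probability_setT.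
have step K : \sum_(k < K) (a * (3 / 4) * \int[P]_w R2 k.+1 w -
    a / eta * \int[P]_w E2 k.+1 w) <= C0.
  have lk k : L1 (fun w => a * (3 / 4) * R2 k.+1 w - a / eta * E2 k.+1 w).
    by apply: L1B; exact: L1Z.
  have -> : C0 = \int[P]_w (A + B * E2 0%N w).
    rewrite L1_RintegralD//; [|exact: L1_cst|exact: L1Z].
    by rewrite L1_RintegralZl// Rintegral_cst// P1 mulr1.
  rewrite (eq_bigr (fun k : 'I_K =>
    \int[P]_w (a * (3 / 4) * R2 k.+1 w - a / eta * E2 k.+1 w))); last first.
    by move=> k _; rewrite L1_RintegralB ?L1_RintegralZl//; exact: L1Z.
  rewrite -L1_Rintegral_sum//; apply: L1_le_Rintegral => //.
  - exact: L1_sum.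
  - by apply: L1D; [exact: L1_cst|exact: L1Z].
  - by move=> w _; exact: path_descent.
have R2i0 k : 0 <= \int[P]_w R2 k w by apply: Rintegral_ge0 => w _.
have SK K : a / 2 * S K <= C0 + a / eta * iota0 ^+ 2 * D.
  apply: (@le_trans _ _ (C0 + a / eta * iota0 ^+ 2 * Dl K)); last first.
    rewrite lerD2l; apply: ler_wpM2l; last exact: sum_delta.
    by rewrite mulr_ge0 ?sqr_ge0// divr_ge0 ?ltW.
  rewrite -lerBlDr; apply: le_trans (step K).
  rewrite /S /Dl !mulr_sumr -sumrB; apply: ler_sum => k _.
  have ae0 : 0 <= a / eta by rewrite divr_ge0 ?ltW.
  have := ler_wpM2l ae0 (condC k.+1).
  have := mulr_ge0 (ltW a0) (R2i0 k.+1).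
  move: (\int[P]_w R2 k.+1 w) (\int[P]_w E2 k.+1 w) => r e r0.
  have -> : a / eta * (eta ^+ 2 / 4 * r + iota0 ^+ 2 * delta k.+1 ^+ 2) =
    eta * (a * r) / 4 + a / eta * iota0 ^+ 2 * delta k.+1 ^+ 2.
    by field; rewrite gt_eqF.
  have er : eta * (a * r) <= a * r by rewrite ler_piMl// ltW.
  have -> : a / 2 * r = a * r / 2 by ring.
  have -> : a * (3 / 4) * r = 3 / 4 * (a * r) by ring.
  move: er r0; move: (eta * (a * r)) (a * r) (a / eta * iota0 ^+ 2 * _) (a / eta * e).
  by move=> *; lra.
(* [2 / a] inverts the factor [a / 2] of [SK]; the leading 4 is a rounded
   [2 * (1 + eta ^+ 2 / 4)]. *)
exists (4 * (2 / a * (C0 + a / eta * iota0 ^+ 2 * D)) + 2 * iota0 ^+ 2 * D) => K.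
apply: (@le_trans _ _ (4 * S K + 2 * iota0 ^+ 2 * Dl K)); last first.
  apply: lerD; last by apply: ler_wpM2l; [rewrite mulr_ge0 ?sqr_ge0|exact: sum_delta].
  rewrite ler_pM2l//; have a2 : 0 <= 2 / a by rewrite divr_ge0// ltW.
  have := ler_wpM2l a2 (SK K).
  by have -> : 2 / a * (a / 2 * S K) = S K by field; rewrite gt_eqF.
rewrite /S /Dl !mulr_sumr -big_split; apply: ler_sum => k _ /=.
have : \int[P]_w T2 k.+1 w <= 2 * (\int[P]_w E2 k.+1 w + \int[P]_w R2 k.+1 w).
  rewrite -L1_RintegralD// -L1_RintegralZl//; last exact: L1D.
  by apply: L1_le_Rintegral => //; apply: L1Z; exact: L1D.
have := condC k.+1; have := R2i0 k.+1.
move: (\int[P]_w R2 k.+1 w) (\int[P]_w E2 k.+1 w) (\int[P]_w T2 k.+1 w) => r e t.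
move=> r0; have : eta ^+ 2 * r <= r by rewrite ler_piMl// exprn_ile1 ?ltW.
rewrite [eta ^+ 2 / 4 * r]mulrAC -[2 * _ * delta _ ^+ 2]mulrA.
by move: r0; move: (eta ^+ 2 * r) (iota0 ^+ 2 * _) => *; lra.
Qed.

End summation.

Lemma sqrV_le_powRN (R : realType) (e p : R) : 0 < e <= 1 -> 2 <= p ->
  (e ^+ 2)^-1 <= e `^ (- p).
Proof.
move=> e01 p2; have /andP[e0 _] := e01.
rewrite powRN lef_pV2 ?posrE ?exprn_gt0 ?powR_gt0//.
by rewrite -(powR_mulrn 2 (ltW e0)); exact: ger_powR.
Qed.

Lemma complexity_bound {R : realType} {d0 : measure_display}
    {T : measurableType d0} (P : probability T R)
    (cond : R -> nat -> T -> Prop) (N : nat -> T -> nat)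
    (t : nat -> R) (r den : nat -> T -> R) (C1 c0 s p : R) :
  (forall eps k w, cond eps k w <-> t k <= eps \/ r k w <= eps) ->
  (forall K, \sum_(k < K) t k.+1 <= C1) ->
  0 < c0 -> 0 <= s -> 2 <= p -> (forall k w, 0 < den k w) ->
  {ae P, forall w, forall k, r k w <= c0 * den k w} ->
  (forall k w, (N k w)%:R <= 1 + s / den k w) ->
  complexity_O P cond N p.
Proof.
move=> condE tC1 c00 s0 p2 den0 rden Nden.
have C10 : 0 <= C1 by have := tC1 0%N; rewrite big_ord0.
(* First factor: iterations, at most [(C1 + 1) / eps]; second: samples per iteration, at most
   [(1 + s * c0) / eps]. Both use [eps <= 1] to absorb a 1. *)
exists ((C1 + 1) * (1 + s * c0)), 1; split => // eps /andP[e0 e1].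
pose M := (Num.truncn (C1 / eps)).+1.
have Ce0 : 0 <= C1 / eps by rewrite divr_ge0// ltW.
have [M1 M2] : C1 < M%:R * eps /\ M%:R <= (C1 + 1) / eps.
  have /andP[h1 h2] := truncn_itv Ce0; split; first by rewrite -ltr_pdivrMr.
  by rewrite mulrDl mul1r /M -natr1 lerD// -[leLHS]invr1 lef_pV2 ?posrE.
(* [t 0] is outside the summation bound, so indices 1 to [M] are tested: were all these [t] above
   [eps], their sum would be at least [M%:R * eps > C1]. The index found does not depend on [w]. *)
have [K0 KM tK0] : exists2 k, (k <= M)%N & t k <= eps.
  apply: contrapT => nk.
  have gt k : (k < M)%N -> eps <= t k.+1.
    by move=> kM; apply/ltW; rewrite ltNge; apply/negP => tk; apply: nk; exists k.+1.
  have : M%:R * eps <= \sum_(k < M) t k.+1.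
    rewrite mulr_natl -[in leLHS](card_ord M) -sumr_const.
    by apply: ler_sum => k _; exact: gt.
  by move=> /le_trans /(_ (tC1 M)); rewrite leNgt M1.
apply: filterS rden => w rw.
have exK : exists k, `[< cond eps k w >].
  by exists K0; apply/asboolP/condE; left.
case: (ex_minnP exK) => K /asboolP cK minK; exists K; split=> //.
have nc k : (k < K)%N -> ~ cond eps k w.
  by move=> kK ck; have := minK k; rewrite leqNgt kK => /(_ (asboolT ck)).
split=> //.
have KM' : (K <= M)%N.
  by apply: leq_trans KM; apply: minK; apply/asboolP/condE; left.
have Nk (k : 'I_K) : (N k w)%:R <= (1 + s * c0) / eps.
  apply: (le_trans (Nden _ _)).
  have rk : eps < c0 * den k w.
    apply: lt_le_trans (rw k); rewrite ltNge; apply/negP => rk.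
    by apply: (nc k) => //; apply/condE; right.
  rewrite [leRHS]mulrDl mul1r; apply: lerD.
    by rewrite -[leLHS]invr1 lef_pV2 ?posrE.
  rewrite -mulrA ler_wpM2l// ler_pdivlMr// mulrC ler_pdivrMr//.
  exact: ltW.
apply: (@le_trans _ _ (\sum_(k < K) (1 + s * c0) / eps)); first exact: ler_sum.
have B0 : 0 <= 1 + s * c0 by rewrite addr_ge0// mulr_ge0// ltW.
rewrite sumr_const card_ord -mulr_natl.
apply: (@le_trans _ _ ((C1 + 1) / eps * ((1 + s * c0) / eps))).
  apply: ler_wpM2r; first by rewrite divr_ge0// ltW.
  by apply: le_trans M2; rewrite ler_nat.
have -> : (C1 + 1) / eps * ((1 + s * c0) / eps) =
  (C1 + 1) * (1 + s * c0) * (eps ^+ 2)^-1 by field; rewrite gt_eqF.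
apply: ler_wpM2l; first by rewrite mulr_ge0// addr_ge0.
by apply: sqrV_le_powRN => //; rewrite e0.
Qed.

Lemma sum_inv_sqr (R : realType) K :
  \sum_(k < K) ((k.+2%:R : R) ^+ 2)^-1 <= 1.
Proof.
(* The sharper bound telescopes, as [1 / (k + 1) ^ 2 <= 1 / k - 1 / (k + 1)]. *)
suff : \sum_(k < K) ((k.+2%:R : R) ^+ 2)^-1 <= 1 - (K.+1%:R)^-1.
  by move=> /le_trans; apply; rewrite lerBlDr lerDl invr_ge0.
elim: K => [|K IH]; first by rewrite big_ord0 invr1 subrr.
rewrite big_ord_recr /=; apply: (le_trans (lerD IH (lexx _))).
have k0 : 0 < K.+1%:R :> R by [].
rewrite -(natr1 K.+1); move: (K.+1%:R : R) k0 => k k0.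
rewrite -subr_ge0.
have -> : 1 - (k + 1)^-1 - (1 - k^-1 + ((k + 1) ^+ 2)^-1) =
  (k * (k + 1) ^+ 2)^-1 by field; rewrite !gt_eqF// addr_gt0.
by rewrite invr_ge0 mulr_ge0 ?sqr_ge0// ltW.
Qed.

(** * The algorithm *)

Section filtration.
Context {R : realType} {d : nat} {d0 : measure_display} {T : measurableType d0}.
Variable g : nat -> T -> 'rV[R]_d.

(** The generators of [sigma_gen g k], named so that the history can be used as a measurable
    type. *)
Definition sigma_gens k : set (set T) :=
  [set A | exists (i : nat) (j : 'I_d) (B : set R),
     (i < k)%N /\ measurable B /\ A = (fun w => g i w ord0 j) @^-1` B].

Lemma sigma_gens_measurable k : (forall i, (i < k)%N -> mfunv (g i)) ->
  <<s sigma_gens k >> `<=` measurable.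
Proof.
move=> mg; apply: smallest_sub; first exact: sigma_algebra_measurable.
move=> _ [i [j [B [ik [mB ->]]]]]; rewrite -[X in measurable X]setTI.
exact: (mg i ik j).
Qed.

Lemma sigma_gens_mono k (Y : T -> 'rV[R]_d) :
  @mfunv R d _ (g_sigma_algebraType (sigma_gens k)) Y ->
  @mfunv R d _ (g_sigma_algebraType (sigma_gens k.+1)) Y.
Proof.
move=> mY j _ B mB; have := mY j measurableT B mB.
apply: (@sub_sigma_algebra2 _ setT) => D [i [l [C [ik H]]]].
by exists i, l, C; split; first exact: ltnW.
Qed.

Lemma sigma_gens_last k :
  @mfunv R d _ (g_sigma_algebraType (sigma_gens k.+1)) (g k).
Proof.
by move=> j _ B mB; rewrite setTI; apply: sub_sigma_algebra; exists k, j, B.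
Qed.

End filtration.

Section algorithm.
Context {R : realType} {d : nat} {d0 d1 : measure_display}.
Context {T : measurableType d0} {Xi : measurableType d1}.
Variables (P : probability T R) (Pxi : probability Xi R).
Variables (F : 'rV[R]_d -> Xi -> R) (GF : 'rV[R]_d -> Xi -> 'rV[R]_d).
Variables (f : 'rV[R]_d -> R) (gradf : 'rV[R]_d -> 'rV[R]_d).
Variables (h : 'rV[R]_d -> \bar R) (L sigma eta iota0 alpha m : R).
Variables (delta : nat -> R) (x0 : 'rV[R]_d) (x g : nat -> T -> 'rV[R]_d).
Variables (N : nat -> T -> nat) (xi : nat -> nat -> T -> Xi).
Variable ER : nat -> T -> 'rV[R]_d.
Hypothesis mF : forall y, measurable_fun setT (F y).
Hypothesis gF : forall s, has_gradient (F^~ s) (GF^~ s).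
Hypothesis GFgradf : forall y (j : 'I_d),
  Pxi.-integrable setT (fun s => (GF y s ord0 j)%:E) /\
  (\int[Pxi]_s (GF y s ord0 j)%:E = (gradf y ord0 j)%:E)%E.
Hypotheses (L0 : 0 < L) (fL : smooth_L L f gradf).
Hypotheses (hp : proper_fun h) (hc : convex_fun h) (hcl : closed_fun h).
Hypothesis hm : forall y, (m%:E <= (f y)%:E + h y)%E.
Hypothesis assumptionV : forall (k : nat) (z : T -> Xi), has_law P Pxi z ->
  mut_indep P (fun b : bool => if b then sigma_gen g k else sigma_of z) ->
  exists Y, is_cond_exp P (sigma_gen g k)
              (fun w => nrm2 (GF (x k w) (z w) - gradf (x k w))) Y /\
            {ae P, forall w, Y w <= sigma ^+ 2}.
Hypotheses (eta01 : 0 < eta < 1) (a0 : 0 < alpha).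
Hypothesis aL : alpha <= (1 - eta) / (2 * L).
Hypothesis x0E : forall w, x 0%N w = x0.
Hypothesis xS : forall k w, x k.+1 w = prox h alpha (x k w - alpha *: g k w).
Hypothesis ERP : forall k, is_cond_expv P (sigma_gen g k)
  (fun w => alpha^-1 *: (x k w - x k.+1 w)) (ER k).
Hypothesis xi_law : forall k i, has_law P Pxi (xi k i).
Hypothesis xi_indep : forall k, mut_indep P (fun o : option nat =>
  match o with None => sigma_gen g k | Some i => sigma_of (xi k i) end).
Hypothesis gE : forall k w,
  g k w = (N k w)%:R^-1 *: \sum_(i < N k w) GF (x k w) (xi k i w).

Let den k w := eta ^+ 2 / 4 * nrm2 (ER k w) + iota0 ^+ 2 * delta k ^+ 2.

Hypothesis den_gt0 : forall k w, 0 < den k w.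
Hypothesis NE : forall k w,
  N k w = maxn 1 `|Num.ceil (sigma ^+ 2 / den k w)|%N.

Notation L1 u := (P.-integrable setT (EFin \o u)).
Notation Gk k := (g_sigma_algebraType (sigma_gens g k)).

Let aL1 : alpha * L < 1.
Proof.
have /andP[eta0 _] := eta01.
by move: aL; rewrite ler_pdivlMr ?mulr_gt0//; lra.
Qed.

Let cgradf : continuous gradf. Proof. by have [_ []] := fL. Qed.

Lemma ER_mfunv k : @mfunv R d _ (Gk k) (ER k).
Proof. by move=> j; have [mY _] := ERP k j; exact/G_measurableE. Qed.

Lemma den_measurable k : measurable_fun (setT : set (Gk k)) (den k).
Proof.
apply: measurable_funD => //; apply: measurable_funM => //.
by apply: measurable_nrm2; exact: ER_mfunv.
Qed.

Lemma N_measurable k n : <<s sigma_gens g k >> [set w | N k w = n].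
Proof.
suff : measurable ([set w | N k w = n] : set (Gk k)) by [].
have -> : [set w | N k w = n] = \bigcup_(c : int)
    ([set w | Num.ceil (sigma ^+ 2 / den k w) = c] `&`
     [set w | maxn 1 `|c|%N = n]).
  apply/seteqP; split => w /=; rewrite NE.
    by move=> Nn; exists (Num.ceil (sigma ^+ 2 / den k w)).
  by move=> [c _ [<-]].
apply: countable_bigcupT_measurable => [|c]; first exact: countableP.
apply: measurableI.
  exact: (@measurable_ceil_div _ _ (Gk k) _ _ _ (@den_measurable k) (den_gt0 k)).
have [cn|/eqP cn] := eqVneq (maxn 1 `|c|%N) n.
  have -> : [set _ | maxn 1 `|c|%N = n] = [set: Gk k] by apply/seteqP; split.
  exact: measurableT.
have -> : [set _ | maxn 1 `|c|%N = n] = set0 :> set (Gk k).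
  by apply/seteqP; split.
exact: measurable0.
Qed.

(** The two claims need each other: measurability of the earlier estimates makes [G_k] a
    sub-sigma-algebra, over which [g k] is a sampled average at a [G_k]-measurable point, hence
    measurable; then [x k.+1] depends on [x k] and the new generator [g k]. *)
Lemma adapted k : (forall i, (i < k)%N -> mfunv (g i)) /\
  @mfunv R d _ (Gk k) (x k).
Proof.
elim: k => [|k [mg mx]].
  split=> // j; rewrite (_ : (fun w => _) = cst (x0 ord0 j)) //.
  by apply/funext => w; rewrite x0E.
have genT := sigma_gens_measurable mg.
have gs : g k = sampled GF (x k) (xi k) (N k) by apply/funext => w; rewrite gE.
have mgk : mfunv (g k).
  by rewrite gs; exact: (sampled_mfunv genT gF mF mx (xi_law k) (@N_measurable k)).
split.
  by move=> i; rewrite ltnS leq_eqVlt => /predU1P[->//|]; exact: mg.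
have -> : x k.+1 = prox h alpha \o (fun w => x k w - alpha *: g k w).
  by apply/funext => w; rewrite xS.
apply: continuous_comp_mfunv.
  exact: (prox_continuous L0 fL a0 aL1 hp hc hcl hm).
apply: mfunvB; first exact: sigma_gens_mono.
by apply: mfunvZ; exact: sigma_gens_last.
Qed.

Let genT k : <<s sigma_gens g k >> `<=` measurable.
Proof. by apply: sigma_gens_measurable; have [] := adapted k. Qed.

Let xG k : @mfunv R d _ (Gk k) (x k). Proof. by have [] := adapted k. Qed.

Let mx k : mfunv (x k). Proof. exact: (sub_mfunv (@genT k) (@xG k)). Qed.

Let mg k : mfunv (g k). Proof. by have [+ _] := adapted k.+1; apply. Qed.

(** Restricts the joint independence of history and samples to one sample, the form in which
    Assumption V asks for it. *)
Lemma xi_indep2 k i : mut_indep P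
  (fun b : bool => if b then sigma_gen g k else sigma_of (xi k i)).
Proof.
move=> s A us sA.
pose o (b : bool) := if b then None else Some i.
pose A' (c : option nat) := if c is None then A true else A false.
have oinj : injective o by do 2 case.
have := @xi_indep k (map o s) A'; rewrite (map_inj_uniq oinj) => /(_ us).
have A'E b : A' (o b) = A b by case: b.
move=> H; rewrite [in RHS](eq_bigr (fun b => fine (P (A' (o b))))); last first.
  by move=> b _; rewrite A'E.
rewrite -(big_map o xpredT (fun c => fine (P (A' c)))) -H.
  congr (fine (P _)); apply/seteqP; split => w Aw.
    by move=> c /= /mapP[b bs ->]; rewrite A'E; exact: Aw.
  by move=> b /= bs; rewrite -A'E; apply: Aw => /=; exact: map_f.
by move=> c /mapP[b bs ->]; rewrite A'E; have := sA b bs; case: b {bs}.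
Qed.

Lemma noise_var k i A : <<s sigma_gens g k >> A ->
  (\int[P]_(w in A) (nrm2 (noise GF gradf (x k) (xi k) i w))%:E
   <= (sigma ^+ 2)%:E * P A)%E.
Proof.
have [Y [cY Yle]] := assumptionV (xi_law k i) (@xi_indep2 k i).
exact: (cond_exp_le (@genT k) cY Yle).
Qed.

Definition err k w := g k w - gradf (x k w).

Definition res k w := alpha^-1 *: (x k w - x k.+1 w).

Definition rtrue k w := Rtrue gradf h alpha (x k w).

Lemma N_ge k w : sigma ^+ 2 / (N k w)%:R <= den k w.
Proof.
have N0 : 0 < (N k w)%:R :> R by rewrite ltr0n NE leq_max.
rewrite ler_pdivrMr// mulrC -ler_pdivrMr//.
apply: (le_trans (ceil_ge _)); rewrite NE.
apply: (@le_trans _ _ (`|Num.ceil (sigma ^+ 2 / den k w)|%N%:R)); last first.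
  by rewrite ler_nat leq_maxr.
by rewrite natr_absz intr_norm ler_norm.
Qed.

(** Rounding up and the minimum of one sample each cost at most one extra sample, and not both at
    once. *)
Lemma N_le k w : (N k w)%:R <= 1 + sigma ^+ 2 / den k w.
Proof.
have y0 : 0 <= sigma ^+ 2 / den k w by rewrite divr_ge0 ?sqr_ge0// ltW.
rewrite NE natr_max ge_max; apply/andP; split; first by rewrite lerDl.
have /andP[h1 _] := ceil_itv (sigma ^+ 2 / den k w).
rewrite natr_absz ger0_norm; last by rewrite ceil_ge0 (lt_le_trans _ y0)// ltrN10.
by move: h1; rewrite intrB ltrBlDr addrC => /ltW.
Qed.

Lemma err_var k A : <<s sigma_gens g k >> A ->
  (\int[P]_(w in A) (nrm2 (err k w))%:E <=
   \int[P]_(w in A) (sigma ^+ 2 / (N k w)%:R)%:E)%E.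
Proof.
move=> GA.
have N0 w : (0 < N k w)%N by rewrite NE leq_max.
have gs : g k = sampled GF (x k) (xi k) (N k) by apply/funext => w; rewrite gE.
rewrite /err gs.
exact: (sampled_var (@genT k) gF mF GFgradf cgradf (@xG k) (xi_law k)
  (@xi_indep k) (@noise_var k) N0 (@N_measurable k) GA).
Qed.

Lemma err_mfunv k : mfunv (err k).
Proof. by apply: mfunvB => //; exact: continuous_comp_mfunv. Qed.

Lemma res_mfunv k : mfunv (res k).
Proof. by apply: mfunvZ; exact: mfunvB. Qed.

Let Rlip := Rtrue_lip L0 fL a0 aL1 hp hc hcl hm.

Let cRtrue : continuous (Rtrue gradf h alpha).
Proof. by have [C [_ H]] := Rlip; exact: lip_continuous H. Qed.

Lemma rtrue_mfunvG k : @mfunv R d _ (Gk k) (rtrue k).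
Proof. exact: (@continuous_comp_mfunv _ _ _ (Gk k) (Rtrue gradf h alpha)). Qed.

Lemma rtrue_mfunv k : mfunv (rtrue k).
Proof. exact: (@continuous_comp_mfunv _ _ _ T (Rtrue gradf h alpha)). Qed.

Let GT k : <<s sigma_gens g k >> setT. Proof. exact: (@measurableT _ (Gk k)). Qed.

(** Only [N >= 1] is used. A bound through [den] would be circular, as integrability of [den] rests
    on that of the residual and hence on this. *)
Lemma err_L2 k : L1 (fun w => nrm2 (err k w)).
Proof.
apply: L1_ge0_lty => [|w|].
- by apply: measurable_nrm2; exact: err_mfunv.
- exact: nrm2_ge0.
apply: (le_lt_trans (err_var (@GT k))).
apply: (@le_lt_trans _ _ (\int[P]_w (sigma ^+ 2)%:E)%E); last first.
  by rewrite L1_EFin ?ltry//; exact: L1_cst.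
apply: ge0_le_integral => //.
- by move=> w _; rewrite lee_fin divr_ge0 ?sqr_ge0.
- apply/measurable_EFinP.
  exact: (measurable_N_cases (@genT k) (@N_measurable k) (u := fun n _ => sigma ^+ 2 / n%:R)).
- move=> w _; rewrite lee_fin ler_pdivrMr ?ltr0n; last by rewrite NE leq_max.
  by rewrite ler_peMr ?sqr_ge0// ler1n NE leq_max.
Qed.

Lemma resE k w : res k w = residual alpha h (x k w) (g k w).
Proof. by rewrite /res xS. Qed.

Lemma res_rtrue k w : nrm2 (res k w - rtrue k w) <= nrm2 (err k w).
Proof. by rewrite resE; exact: (residual_error L0 fL a0 aL1 hp hc hcl hm). Qed.

Lemma nrm2_L1 (Y : T -> 'rV[R]_d) (u : T -> R) : mfunv Y ->
  (forall w, nrm2 (Y w) <= u w) -> L1 u -> L1 (fun w => nrm2 (Y w)).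
Proof.
move=> mY Yu; apply: L1_le; first exact: measurable_nrm2.
by move=> w; rewrite ger0_norm ?nrm2_ge0.
Qed.

Lemma nrm2_le_add (u v : 'rV[R]_d) : nrm2 u <= 2 * (nrm2 (u - v) + nrm2 v).
Proof. by have := nrm2D_le (u - v) v; rewrite subrK. Qed.

(** Induction on the iterate: [rtrue] is Lipschitz in [x k], [res] differs from it by at most the
    error, and [x k.+1] is [x k] minus [alpha *: res k]. *)
Lemma L2_bounds k : [/\ L1 (fun w => nrm2 (x k w)),
  L1 (fun w => nrm2 (rtrue k w)) & L1 (fun w => nrm2 (res k w))].
Proof.
have rt_L2 j : L1 (fun w => nrm2 (x j w)) -> L1 (fun w => nrm2 (rtrue j w)).
  move=> lx; have [C [C0 HC]] := Rlip.
  apply: (nrm2_L1 (@rtrue_mfunv j) (u := fun w =>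
    2 * (C * nrm2 (x j w) + nrm2 (Rtrue gradf h alpha 0)))).
    move=> w; apply: (le_trans (nrm2_le_add _ (Rtrue gradf h alpha 0))).
    rewrite ler_pM2l// lerD2r; have := HC (x j w) 0; rewrite subr0.
    by move=> /le_trans; apply.
  by apply: L1Z; apply: L1D; [exact: L1Z|exact: L1_cst].
have res_L2 j : L1 (fun w => nrm2 (rtrue j w)) -> L1 (fun w => nrm2 (res j w)).
  move=> lr; apply: (nrm2_L1 (@res_mfunv j) (u := fun w =>
    2 * (nrm2 (err j w) + nrm2 (rtrue j w)))).
    move=> w; apply: (le_trans (nrm2_le_add _ (rtrue j w))).
    by rewrite ler_pM2l// lerD2r res_rtrue.
  by apply: L1Z; apply: L1D => //; exact: err_L2.
suff lx : L1 (fun w => nrm2 (x k w)) by split=> //; [exact: rt_L2|exact/res_L2/rt_L2].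
elim: k => [|k IH].
  by apply: (nrm2_L1 (@mx 0) (u := fun=> nrm2 x0)) => [w|]; [rewrite x0E|exact: L1_cst].
apply: (nrm2_L1 (@mx k.+1) (u := fun w =>
  2 * (nrm2 (x k w) + alpha ^+ 2 * nrm2 (res k w)))).
  move=> w; have -> : x k.+1 w = x k w + (- alpha) *: res k w.
    by rewrite /res scalerA mulNr divff ?gt_eqF// scaleN1r opprB addrC subrK.
  by apply: (le_trans (nrm2D_le _ _)); rewrite nrm2Z sqrrN.
by apply: L1Z; apply: L1D => //; apply: L1Z; exact/res_L2/rt_L2.
Qed.

Let res_L2 k : L1 (fun w => nrm2 (res k w)). Proof. by have [] := L2_bounds k. Qed.

Let rtrue_L2 k : L1 (fun w => nrm2 (rtrue k w)).
Proof. by have [] := L2_bounds k. Qed.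

Lemma ER_jensen k : L1 (fun w => nrm2 (ER k w)) /\
  forall A, <<s sigma_gens g k >> A ->
    \int[P]_(w in A) nrm2 (ER k w) <= \int[P]_(w in A) nrm2 (res k w).
Proof. exact: (cond_expv_jensen (@genT k) (@res_mfunv k) (@res_L2 k) (ERP k)). Qed.

Lemma den_L1 k : L1 (den k).
Proof.
by apply: L1D; [apply: L1Z; have [] := ER_jensen k|exact: L1_cst].
Qed.

Lemma condition_C k A : <<s sigma_gens g k >> A ->
  \int[P]_(w in A) nrm2 (err k w) <= \int[P]_(w in A) den k w.
Proof.
move=> GA; have mA := @genT k _ GA.
rewrite -lee_fin -!L1_EFin//; [|exact: den_L1|exact: err_L2].
apply: (le_trans (err_var GA)); apply: ge0_le_integral => //.
- by move=> w _; rewrite lee_fin divr_ge0 ?sqr_ge0.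
- apply: measurable_funTS; apply/measurable_EFinP.
  exact: (measurable_N_cases (@genT k) (@N_measurable k) (u := fun n _ => sigma ^+ 2 / n%:R)).
- by apply: measurable_funTS; apply/measurable_EFinP; exact: L1_measurable (den_L1 k).
- by move=> w _; rewrite lee_fin N_ge.
Qed.

Lemma condition_C_total k : \int[P]_w nrm2 (err k w) <=
  eta ^+ 2 / 4 * \int[P]_w nrm2 (res k w) + iota0 ^+ 2 * delta k ^+ 2.
Proof.
have [lER ERle] := ER_jensen k.
apply: (le_trans (condition_C (@GT k))); rewrite /den.
rewrite L1_RintegralD//; [|exact: L1Z|exact: L1_cst].
have P1 : fine (P setT) = 1 by rewrite probability_setT.
rewrite L1_RintegralZl// Rintegral_cst// P1 mulr1 lerD2r.
by apply: ler_wpM2l; [rewrite divr_ge0 ?sqr_ge0|exact: ERle].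
Qed.

Lemma coord_L1 (Y : T -> 'rV[R]_d) j : mfunv Y -> L1 (fun w => nrm2 (Y w)) ->
  L1 (fun w => Y w ord0 j).
Proof.
move=> mY lY; apply: (L1_le (g := fun w => 1 + nrm2 (Y w))); first exact: mY.
  move=> w; have := sqr_coord_le (Y w) j; move: (nrm2 _) (Y w ord0 j) => n y.
  by rewrite ler_norml => yn; apply/andP; split; nra.
by apply: L1D => //; exact: L1_cst.
Qed.

(** As [rtrue k] is [G_k]-measurable, [ER k - rtrue k] is a version of the conditional expectation
    of [res k - rtrue k]; Jensen, nonexpansiveness and Condition C compare its square with [den k]
    on every set of [G_k]. *)
Lemma ER_rtrue_ae k : {ae P, forall w, nrm2 (ER k w - rtrue k w) <= den k w}.
Proof.
have mdiff : mfunv (fun w => res k w - rtrue k w).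
  by apply: mfunvB; [exact: res_mfunv|exact: rtrue_mfunv].
have ldiff : L1 (fun w => nrm2 (res k w - rtrue k w)).
  exact: nrm2_L1 mdiff (@res_rtrue k) (@err_L2 k).
have cdiff : is_cond_expv P <<s sigma_gens g k >>
    (fun w => res k w - rtrue k w) (fun w => ER k w - rtrue k w).
  move=> j.
  have -> : (fun w => (res k w - rtrue k w) ord0 j) =
    (fun w => res k w ord0 j - rtrue k w ord0 j) by apply/funext => w; rewrite !mxE.
  have -> : (fun w => (ER k w - rtrue k w) ord0 j) =
    (fun w => ER k w ord0 j - rtrue k w ord0 j) by apply/funext => w; rewrite !mxE.
  apply: (is_cond_expB (@genT k)); last exact: ERP.
  - by apply: coord_L1 => //; exact: res_mfunv.
  - by apply: coord_L1 => //; exact: rtrue_mfunv.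
  - exact: rtrue_mfunvG.
have [lER ERle] := cond_expv_jensen (@genT k) mdiff ldiff cdiff.
apply: (ae_le_of_Rintegral (@genT k) lER (den_L1 k)).
- by apply: measurable_nrm2; apply: mfunvB; [exact: ER_mfunv|exact: rtrue_mfunvG].
- exact: den_measurable.
- move=> A GA; apply: (le_trans (ERle A GA)).
  apply: le_trans (@condition_C k A GA); apply: L1_le_Rintegral => //.
  + exact: (@genT k).
  + exact: err_L2.
  + by move=> w _; exact: res_rtrue.
Qed.

Lemma rtrue_den_ae : {ae P, forall w, forall k,
  nrm2 (rtrue k w) <= 2 * (1 + 4 / eta ^+ 2) * den k w}.
Proof.
have /andP[eta0 _] := eta01.
(* One null set must serve all [k], because the stopping index depends on [w]. *)
apply: ae_foralln => k; apply: filterS (ER_rtrue_ae k) => w H.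
apply: (le_trans (nrm2_le_add _ (ER k w))).
rewrite -mulrA ler_pM2l// mulrDl mul1r; apply: lerD; first by rewrite nrm2BC.
rewrite /den mulrDr mulrA.
have -> : 4 / eta ^+ 2 * (eta ^+ 2 / 4) = 1 by field; rewrite gt_eqF.
rewrite mul1r lerDl; apply: mulr_ge0; first by rewrite divr_ge0 ?sqr_ge0.
by rewrite mulr_ge0 ?sqr_ge0.
Qed.

(** The objective telescopes from [x 1], where it is finite and controlled by the first error, down
    to the lower bound [m]. *)
Lemma path_descent : exists A B, forall K w,
  \sum_(k < K) (alpha * (3 / 4) * nrm2 (res k.+1 w)
                - alpha / eta * nrm2 (err k.+1 w)) <= A + B * nrm2 (err 0 w).
Proof.
have /andP[eta0 _] := eta01.
have [A [B [_ AB]]] := proxgrad_first_step L0 fL a0 aL1 hp hc hcl hm x0.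
exists (A - m), B => K w.
have xfin k : h (x k.+1 w) \is a fin_num.
  by rewrite xS; exact: (proxgrad_step_fin_num L0 fL a0 aL1 hp hc hcl hm).
have H0 : objective f h (x 1 w) <= A + B * nrm2 (err 0 w).
  by rewrite xS /err x0E; exact: AB.
have step k : alpha * (3 / 4) * nrm2 (res k.+1 w) - alpha / eta * nrm2 (err k.+1 w)
    <= objective f h (x k.+1 w) - objective f h (x k.+2 w).
  have := proxgrad_descent L0 fL a0 aL1 hp hc hcl hm (g k.+1 w) eta0 aL (xfin k).
  rewrite -resE -/(err k.+1 w) /proxgrad_step -xS.
  move: (objective _ _ (x k.+1 w)) (objective _ _ (x k.+2 w)) => p q.
  by move: (_ * nrm2 (res _ _)) (_ * nrm2 (err _ _)) => r s; lra.
apply: (@le_trans _ _ (\sum_(k < K) (objective f h (x k.+1 w) - objective f h (x k.+2 w)))).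
  by apply: ler_sum => k _; exact: step.
have -> : \sum_(k < K) (objective f h (x k.+1 w) - objective f h (x k.+2 w)) =
    objective f h (x 1 w) - objective f h (x K.+1 w).
  elim: K => [|K IH]; first by rewrite big_ord0 subrr.
  by rewrite big_ord_recr /= IH addrA subrK.
by have := objective_ge hm (xfin K); lra.
Qed.

Lemma proxgrad_complexity (p D : R) : (forall K, \sum_(k < K) delta k.+1 ^+ 2 <= D) ->
  2 <= p -> complexity_O P (fun eps => stop_cond P gradf h alpha x eps) N p.
Proof.
move=> sum_delta p2; have /andP[eta0 _] := eta01.
have [A [B AB]] := path_descent.
have TER k w : nrm2 (rtrue k w) <= 2 * (nrm2 (err k w) + nrm2 (res k w)).
  apply: (le_trans (nrm2_le_add _ (res k w))).
  by rewrite ler_pM2l// lerD2r nrm2BC res_rtrue.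
have [C1 HC1] := sum_expected_residual err_L2 res_L2 rtrue_L2
  (fun k w => nrm2_ge0 (res k w)) eta01 a0 TER condition_C_total AB sum_delta.
apply: (@complexity_bound _ _ _ P _ N (fun k => \int[P]_w nrm2 (rtrue k w))
  (fun k w => nrm2 (rtrue k w)) den C1 (2 * (1 + 4 / eta ^+ 2)) (sigma ^+ 2)) => //.
- move=> eps k w; rewrite /stop_cond.
  have -> : (\int[P]_v (nrm2 (Rtrue gradf h alpha (x k v)))%:E =
      (\int[P]_v nrm2 (rtrue k v))%:E)%E.
    exact: (L1_EFin measurableT (@rtrue_L2 k)).
  rewrite -EFin_min lee_fin ge_min; split => [/orP|] H; first exact: H.
  by apply/orP.
- by rewrite mulr_gt0// addr_gt0// divr_gt0// exprn_gt0.
- exact: sqr_ge0.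
- exact: rtrue_den_ae.
- exact: N_le.
Qed.

End algorithm.

Theorem mainTheorem7
  (R : realType) (d : nat)
  (* probability space and sample space (Xi, Pxi) *)
  (d0 d1 : measure_display) (T : measurableType d0) (P : probability T R)
  (Xi : measurableType d1) (Pxi : probability Xi R)
  (* problem data *)
  (F : 'rV[R]_d -> Xi -> R) (GF : 'rV[R]_d -> Xi -> 'rV[R]_d)
  (f : 'rV[R]_d -> R) (gradf : 'rV[R]_d -> 'rV[R]_d) (h : 'rV[R]_d -> \bar R)
  (L sigma eta iota0 nu alpha : R) (delta : nat -> R) (x0 : 'rV[R]_d)
  (* iterates, estimates, sample sizes, samples, and a version of E_k[R_alpha(y_k)] *)
  (x g : nat -> T -> 'rV[R]_d) (N : nat -> T -> nat) (xi : nat -> nat -> T -> Xi)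
  (ER : nat -> T -> 'rV[R]_d) :
  (* (EX): f = E[F(., xi)], with gradients grad F(., xi) *)
  (forall y, Pxi.-integrable setT (EFin \o F y) /\
             (\int[Pxi]_s (F y s)%:E = (f y)%:E)%E) ->
  (forall s, has_gradient (F^~ s) (GF^~ s)) ->
  (forall y (j : 'I_d), Pxi.-integrable setT (fun s => (GF y s ord0 j)%:E) /\
             (\int[Pxi]_s (GF y s ord0 j)%:E = (gradf y ord0 j)%:E)%E) ->
  (forall (Y : T -> 'rV[R]_d) (z : T -> Xi),
      (forall j : 'I_d, measurable_fun setT (fun w => Y w ord0 j)) ->
      measurable_fun setT z ->
      forall j : 'I_d, measurable_fun setT (fun w => GF (Y w) (z w) ord0 j)) ->
  (* Assumption A *)
  0 < L -> smooth_L L f gradf ->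
  proper_fun h -> convex_fun h -> closed_fun h ->
  (exists m : R, forall y, (m%:E <= (f y)%:E + h y)%E) ->
  (* Assumption V (with y_k = x_k, Option I) *)
  0 <= sigma ->
  (forall (k : nat) (z : T -> Xi), has_law P Pxi z ->
     mut_indep P (fun b : bool => if b then sigma_gen g k else sigma_of z) ->
     exists Y, is_cond_exp P (sigma_gen g k)
                 (fun w => nrm2 (GF (x k w) (z w) - gradf (x k w))) Y /\
               {ae P, forall w, Y w <= sigma ^+ 2}) ->
  (* parameters *)
  0 < eta < 1 ->
  0 <= iota0 -> iota0 < Num.sqrt ((1 - eta) / 2) ->
  0 < nu ->
  0 < alpha -> alpha <= (1 - eta) / (2 * L) ->
  (* Algorithm, Option I, constant step alpha: y_k = x_k *)
  (forall w, x 0%N w = x0) ->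
  (forall k w, x k.+1 w = prox h alpha (x k w - alpha *: g k w)) ->
  (* ER k is a version of E_k[R_alpha(y_k)] = E[(y_k - x_{k+1})/alpha | G_k] *)
  (forall k, is_cond_expv P (sigma_gen g k)
               (fun w => alpha^-1 *: (x k w - x k.+1 w)) (ER k)) ->
  (* sampled estimate: i.i.d. samples with law Pxi, independent of G_k *)
  (forall k i, has_law P Pxi (xi k i)) ->
  (forall k, mut_indep P (fun o : option nat =>
       match o with None => sigma_gen g k | Some i => sigma_of (xi k i) end)) ->
  (forall k w, g k w = (N k w)%:R^-1 *: \sum_(i < N k w) GF (x k w) (xi k i w)) ->
  (* sample-size rule (well defined: positive denominator; at least one sample) *)
  (forall k w, 0 < eta ^+ 2 / 4 * nrm2 (ER k w) + iota0 ^+ 2 * delta k ^+ 2) ->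
  (forall k w, N k w = maxn 1
     `|Num.ceil (sigma ^+ 2 / (eta ^+ 2 / 4 * nrm2 (ER k w)
                               + iota0 ^+ 2 * delta k ^+ 2))|%N) ->
  (* conclusions *)
  ((forall k, delta k = ((k.+1)%:R `^ (1 + nu))^-1) ->
     complexity_O P (fun eps => stop_cond P gradf h alpha x eps) N (2 + nu)) /\
  ((forall k, delta k = 0) ->
     complexity_O P (fun eps => stop_cond P gradf h alpha x eps) N 2).
Proof.
move=> Fint gF GFgradf _ L0 fL hp hc hcl [m hm] _ V eta01 _ _ nu0 a0 aL x0E xS.
move=> ERP xi_law xi_indep gE den0 NE.
have mF y : measurable_fun setT (F y).
  by have [/integrableP[/measurable_EFinP]] := Fint y.
have C := proxgrad_complexity mF gF GFgradf L0 fL hp hc hcl hm V eta01 a0 aL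
  x0E xS ERP xi_law xi_indep gE den0 NE.
split=> deltaE.
  (* The bound 1 works for every [nu]: [delta k.+1] is at most [k.+2%:R^-1], and [sum_inv_sqr] sums
     the squares. *)
  apply: (C _ 1); last by rewrite lerDl ltW.
  move=> K; apply: le_trans (sum_inv_sqr R K); apply: ler_sum => k _.
  have k1 : 1 <= k.+2%:R :> R by rewrite ler1n.
  have k_le : k.+2%:R <= k.+2%:R `^ (1 + nu) :> R.
    by apply: le1r_powR => //; rewrite lerDl ltW.
  have k0 : 0 < k.+2%:R :> R by [].
  rewrite deltaE exprVn lef_pV2 ?posrE ?exprn_gt0 ?powR_gt0//.
  by rewrite ler_sqr ?nnegrE ?powR_ge0.
apply: (C _ 0) => // K.
by rewrite big1// => k _; rewrite deltaE expr0n.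
Qed.
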